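(* Let $M$ be a compact connected $C^1$ manifold, equipped with a Riemannian metric $g$ and the corresponding geodesic metric $\rho_g$, and let $\mu$ be an Ahlfors--David regular positive Borel measure on $M$ (with respect to $\rho_g$). Then $M$ admits a weighted decomposition: there exist constants $d,C^*>0$, depending only on $(M,\rho_g,\mu)$, such that for all positive numbers $\lambda_1,\dots,\lambda_n$ with $\sum_{j=1}^n\lambda_j=\mu(M)$ there exist measurable subsets $X_1,\dots,X_n\subset M$ such that $M=\bigsqcup_{j=1}^n X_j$ (disjoint union), $\mu(X_j)=\lambda_j$ for every $j$, and each $X_j$ is contained in a ball (with respect to $\rho_g$) of radius $C^*\lambda_j^{1/d}$.
   Context: Manifolds may have boundary; charts take values in $\mathbb{R}^m$ or in a closed half-space of $\mathbb{R}^m$. A Riemannian metric on a $C^1$ manifold is a continuous field of inner products on the tangent spaces; the geodesic metric $\rho_g(x,y)$ is the infimum of the $g$-lengths of (piecewise $C^1$) paths joining $x$ and $y$. A Borel measure $\mu$ on a metric space $(X,\rho)$ is Ahlfors--David regular if for some dimension $s$ there is a constant $A\ge1$ with $A^{-1}r^s\le\mu(B(x,r))\le A r^s$ for all $x\in X$ and $0<r\le\operatorname{diam}X$, where $B(x,r)$ is the open ball with centre $x$ and radius $r$.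
   Formalization: The manifold M is assumed to have dimension at least 1: for a one-point manifold the regularity condition (0 < r ≤ diam M = 0) is vacuous, and a unit point mass cannot be split into two sets of measure 1/2. *)

(* Defs.v *)
From HB Require Import structures.
From mathcomp Require Import all_boot all_order all_algebra.
From mathcomp Require Import all_classical all_reals all_analysis.
Set Implicit Arguments.
Unset Strict Implicit.
Unset Printing Implicit Defensive.
Import Order.TTheory GRing.Theory Num.Theory numFieldNormedType.Exports.
Local Open Scope classical_set_scope.
Local Open Scope ring_scope.

(* L is the derivative of f at x relative to D, where D need not be a
   neighbourhood of x (boundary points, endpoints of intervals).  All the
   domains D used below are relatively open in a vector space, in a closed
   half-space or in a nondegenerate interval, so L is unique. *)
Definition is_diff_within (R : realType) (V W : normedModType R)
    (D : set V) (f : V -> W) (x : V) (L : {linear V -> W}) : Prop :=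
  forall e : R, 0 < e ->
    \forall y \near within D (nbhs x),
      `|f y - f x - L (y - x)| <= e * `|y - x|.

(* Only finite-dimensional V are used, for which the pointwise continuity of
   the derivative in x is its continuity in operator norm. *)
Definition C1_on (R : realType) (V W : normedModType R)
    (D : set V) (f : V -> W) : Prop :=
  exists2 df : V -> {linear V -> W},
    (forall x, D x -> is_diff_within D f x (df x)) &
    (forall h : V, {within D, continuous (fun x => df x h)}).

Definition half_space (R : realType) (m : nat) (H : set 'rV[R]_m) : Prop :=
  exists (a : 'cV[R]_m) (b : R),
    a != 0 /\ H = [set x | b <= (x *m a) ord0 ord0].

(* chart_inv is relevant only on the image of chart_dom. *)
Record chart (R : realType) (m : nat) (M : topologicalType) := Chart {
  chart_dom : set M;
  chart_model : set 'rV[R]_m;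
  chart_map :> M -> 'rV[R]_m;
  chart_inv : 'rV[R]_m -> M;
  chart_modelP : chart_model = setT \/ half_space chart_model;
  chart_dom_open : open chart_dom;
  chart_image_open : exists2 O : set 'rV[R]_m,
    open O & chart_map @` chart_dom = chart_model `&` O;
  chart_mapK : forall p, chart_dom p -> chart_inv (chart_map p) = p;
  chart_map_continuous : {within chart_dom, continuous chart_map};
  chart_inv_continuous :
    {within chart_map @` chart_dom, continuous chart_inv} }.

(* Meaningful only on transition_dom c c'. *)
Definition transition (R : realType) (m : nat) (M : topologicalType)
    (c c' : chart R m M) : 'rV[R]_m -> 'rV[R]_m :=
  fun x => c' (chart_inv c x).

Definition transition_dom (R : realType) (m : nat) (M : topologicalType)
    (c c' : chart R m M) : set 'rV[R]_m :=
  c @` (chart_dom c `&` chart_dom c').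

Record C1_manifold (R : realType) (m : nat) := C1Manifold {
  carrier :> ptopologicalType;
  atlas_index : Type;
  atlas : atlas_index -> chart R m carrier;
  manifold_hausdorff : hausdorff_space carrier;
  manifold_second_countable : @second_countable carrier;
  atlas_cover : forall p : carrier, exists i, chart_dom (atlas i) p;
  atlas_C1 : forall i j, C1_on (transition_dom (atlas i) (atlas j))
                               (transition (atlas i) (atlas j)) }.

(* A tangent vector at p is the family v of its coordinate vectors in the
   charts of the atlas: v i, for i a chart at p, transforms by the derivatives
   of the transition maps; for the other charts v i is set to 0, so that the
   tangent space at p is a linear subspace of dimension m of families. *)
Definition tangent (R : realType) (m : nat) (M : C1_manifold R m) (p : M) :
    set (atlas_index M -> 'rV[R]_m) :=
  [set v |
    (forall i, ~ chart_dom (atlas i) p -> v i = 0) /\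
    (forall i j, chart_dom (atlas i) p -> chart_dom (atlas j) p ->
      exists2 L : {linear 'rV[R]_m -> 'rV[R]_m},
        is_diff_within (transition_dom (atlas i) (atlas j))
          (transition (atlas i) (atlas j)) (atlas i p) L &
        v j = L (v i))].

(* Continuity of the field of inner products is continuity of its Gram matrix
   in each chart.  The values of inner p outside tangent p are irrelevant. *)
Record riemannian_metric (R : realType) (m : nat) (M : C1_manifold R m) :=
  RiemannianMetric {
  inner :> forall p : M,
    (atlas_index M -> 'rV[R]_m) -> (atlas_index M -> 'rV[R]_m) -> R;
  inner_linear : forall (p : M) (a : R) u v w,
    tangent p u -> tangent p v -> tangent p w ->
    inner p (a *: u + v) w = a * inner p u w + inner p v w;
  inner_sym : forall (p : M) u v, tangent p u -> tangent p v ->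
    inner p u v = inner p v u;
  inner_pos : forall (p : M) u, tangent p u -> u <> 0 -> 0 < inner p u u;
  inner_continuous : forall i : atlas_index M,
    exists2 G : M -> 'M[R]_m,
      {within chart_dom (atlas i), continuous G} &
      forall p u v, chart_dom (atlas i) p -> tangent p u -> tangent p v ->
        inner p u v = (u i *m G p *m (v i)^T) ord0 ord0 }.

(* Paths are parametrized by [0, 1]; their values elsewhere are irrelevant. *)
Definition piecewise_C1 (R : realType) (m : nat) (M : C1_manifold R m)
    (gam : R -> M) : Prop :=
  {within `[0, 1]%classic, continuous gam} /\
  exists (n : nat) (t : nat -> R),
    [/\ t 0%N = 0, t n = 1,
        forall k, (k < n)%N -> t k < t k.+1 &
        forall k, (k < n)%N -> forall i : atlas_index M,
          C1_on (`[t k, t k.+1]%classic `&` gam @^-1` chart_dom (atlas i))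
                (fun u : R => atlas i (gam u))].

(* For a piecewise C^1 path, this is the velocity except at the finitely many
   break points and endpoints, which do not contribute to the length. *)
Definition velocity (R : realType) (m : nat) (M : C1_manifold R m)
    (gam : R -> M) (u : R) : atlas_index M -> 'rV[R]_m :=
  fun i => if `[< chart_dom (atlas i) (gam u) >]
           then derive1 (fun s : R => atlas i (gam s)) u else 0.

Definition path_length (R : realType) (m : nat) (M : C1_manifold R m)
    (g : riemannian_metric M) (gam : R -> M) : \bar R :=
  (\int[lebesgue_measure]_(u in `[0%R, 1%R])
     (Num.sqrt (g (gam u) (velocity gam u) (velocity gam u)))%:E)%E.

Definition geodesic_dist (R : realType) (m : nat) (M : C1_manifold R m)
    (g : riemannian_metric M) (x y : M) : \bar R :=
  ereal_inf [set path_length g gam | gam in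
    [set gam : R -> M | [/\ piecewise_C1 gam, gam 0 = x & gam 1 = y]]].

Definition dball (R : realType) (X : Type) (rho : X -> X -> \bar R)
    (x : X) (r : R) : set X :=
  [set y | (rho x y < r%:E)%E].

Definition diam (R : realType) (X : Type) (rho : X -> X -> \bar R) : \bar R :=
  ereal_sup [set rho p.1 p.2 | p in [set: X * X]].

Notation borel X := (g_sigma_algebraType (@open X)).

Definition ahlfors_david_regular (R : realType) (X : ptopologicalType)
    (rho : X -> X -> \bar R) (mu : {measure set (borel X) -> \bar R}) : Prop :=
  exists s A : R, 1 <= A /\
    forall (x : X) (r : R), 0 < r -> (r%:E <= diam rho)%E ->
      ((A^-1 * (r `^ s))%:E <= mu (dball rho x r))%E /\
      (mu (dball rho x r) <= (A * (r `^ s))%:E)%E.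

(* Main.v *)
Require Import Defs.
From HB Require Import structures.
From mathcomp Require Import all_boot all_order all_algebra.
From mathcomp Require Import all_classical all_reals all_analysis.
From mathcomp Require Import measurable_realfun ring lra.
Import Order.TTheory GRing.Theory Num.Theory numFieldNormedType.Exports.
Set Implicit Arguments.
Unset Strict Implicit.
Unset Printing Implicit Defensive.
Local Open Scope classical_set_scope.
Local Open Scope ring_scope.

(* The exponent d is free, which leaves room for a crude argument. Items are
   grouped into classes by size, items of class k having size about 2^(-kd) and
   being destined for balls of radius about 2^(-k). A walk of polynomially many
   steps visits all points of a 2^(-k)-net, which exists because M is connected.
   A class of small total size is spread over a single ball; each of the other
   classes receives a fixed fraction of the remaining density, cut up along its
   walk, and its items, laid end to end along the walk, then meet at most two
   consecutive balls each because they are small compared with the share of a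
   ball (with d = 4s + 1). This produces densities that are constant on the
   atoms of a finite algebra; as the measure has no atoms, they are realized by
   disjoint sets, and the null set that remains is distributed to nearby pieces.
   Of the geodesic distance only the following is needed: it is a pseudometric
   with open balls (segments in charts are short) and it is not identically zero
   (the length of a path dominates its displacement in a chart). *)

(** * Fractional allocation *)

(** The exponent counts the losses at scale [2^-k], where a ball has mass about [2^(-ks)]. A class
    that is not spread over a single ball has total mass at least [eta k = 2^(-k-2)] times that of a
    ball, which costs [1 + s]. The density that it receives inside one ball costs another [s]. This
    share is divided by the number of steps of the walk, whose bound is quadratic in the number of
    net points and costs [2s]. The obstacle is that the classes compete for the same space: the mass
    of a class may be anything, so no region can be reserved for it in advance. Densities remove the
    competition, since every dense class is spread over the whole space in proportion to what
    remains. The weights [eta k] add up to at most 1/2, so the sparse classes leave half of the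
    density everywhere, however their balls overlap. Class 0 holds the items without an upper bound
    on their size, and its only set is the whole space. The exponent [s] of regularity is at first
    an arbitrary real number; its positivity, which makes small balls light and so excludes atoms,
    has to be derived. *)

Lemma telescope_ord (V : zmodType) (f : nat -> V) (n : nat) :
  \sum_(i < n) (f i.+1 - f i) = f n - f 0%N.
Proof.
elim: n => [|n IH]; first by rewrite big_ord0 subrr.
by rewrite big_ord_recr /= IH addrC addrA subrK.
Qed.

Section overlap.
Variables (R : realFieldType) (a b c d : R).
Hypotheses (ab : a <= b) (cd : c <= d).

(** For [c <= d], the function [x |-> min x d - min x c] measures, up to a constant, the part of
    [[c, d]] to the left of [x]; its increment from [a] to [b] is the length of the intersection of
    [[a, b]] and [[c, d]]. *)
Let overlap := Num.min b d - Num.min b c - (Num.min a d - Num.min a c).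

Lemma overlap_ge0 : 0 <= overlap.
Proof.
rewrite /overlap; case: (leP b c) => bc.
  have bd := le_trans bc cd; have ac := le_trans ab bc.
  have ad := le_trans ac cd.
  by rewrite (min_idPl bd) (min_idPl ad) (min_idPl ac) !subrr.
case: (leP a c) => ac.
  rewrite (min_idPl (le_trans ac cd)) subrr subr0 subr_ge0 le_min cd andbT.
  exact: ltW.
rewrite opprB addrA subrK subr_ge0.
by rewrite le_min !ge_min ab lexx orbT.
Qed.

Lemma overlap_eq0 : b <= c \/ d <= a -> overlap = 0.
Proof.
rewrite /overlap => -[bc|da].
  have bd := le_trans bc cd; have ac := le_trans ab bc.
  have ad := le_trans ac cd.
  by rewrite (min_idPl bd) (min_idPl bc) (min_idPl ad) (min_idPl ac) !subrr.
have db := le_trans da ab; have ca := le_trans cd da.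
by rewrite (min_idPr db) (min_idPr (le_trans cd db)) (min_idPr da) (min_idPr ca) subrr.
Qed.

End overlap.

(* Items and bins are laid end to end on one interval, and each item is poured
   into the bins that it overlaps; the overlap of two intervals is written
   with minima so that it telescopes in both indices. *)
Lemma consecutive_allocation (R : realFieldType) (n L : nat)
    (lam nu : nat -> R) :
  (forall j, 0 <= lam j) -> (forall b, 0 <= nu b) ->
  \sum_(j < n) lam j = \sum_(b < L) nu b ->
  (L = 1%N \/ forall j b, (j < n)%N -> (b < L)%N -> lam j <= nu b) ->
  exists F : nat -> nat -> R,
    [/\ forall j b, 0 <= F j b,
        forall j, (j < n)%N -> \sum_(b < L) F j b = lam j,
        forall b, (b < L)%N -> \sum_(j < n) F j b = nu b &
        forall j b b', (j < n)%N -> (b < L)%N -> (b' < L)%N ->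
          F j b != 0 -> F j b' != 0 -> (b' <= b.+1)%N].
Proof.
move=> lam0 nu0 E small.
pose P j := \sum_(i < j) lam i; pose Q b := \sum_(c < b) nu c.
have PS j : P j.+1 = P j + lam j by rewrite /P big_ord_recr.
have QS b : Q b.+1 = Q b + nu b by rewrite /Q big_ord_recr.
have Pm : {homo P : i j / (i <= j)%N >-> i <= j}.
  by apply: homo_leq => // [? ? ?|i]; [apply: le_trans|rewrite PS lerDl].
have Qm : {homo Q : i j / (i <= j)%N >-> i <= j}.
  by apply: homo_leq => // [? ? ?|i]; [apply: le_trans|rewrite QS lerDl].
have P0 : P 0%N = 0 by rewrite /P big_ord0.
have Q0 : Q 0%N = 0 by rewrite /Q big_ord0.
have EE : P n = Q L by [].
clearbody P Q; clear E.
pose F j b := Num.min (P j.+1) (Q b.+1) - Num.min (P j.+1) (Q b)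
  - (Num.min (P j) (Q b.+1) - Num.min (P j) (Q b)).
have F0 j b : P j.+1 <= Q b \/ Q b.+1 <= P j -> F j b = 0.
  by apply: overlap_eq0; [apply: Pm|apply: Qm].
exists F; split.
- by move=> j b; apply: overlap_ge0; [apply: Pm|apply: Qm].
- move=> j jn; rewrite sumrB (telescope_ord (fun b => Num.min (P j.+1) (Q b))).
  rewrite (telescope_ord (fun b => Num.min (P j) (Q b))) -EE Q0.
  have h1 := Pm _ _ jn; have h2 := Pm _ _ (leq0n j); rewrite P0 in h2.
  have h3 := le_trans h2 (Pm _ _ (leqnSn j)).
  rewrite (min_idPl h1) (min_idPr h3) (min_idPl (le_trans (Pm _ _ (leqnSn j)) h1)).
  by rewrite (min_idPr h2) !subr0 PS addrC addKr.
- move=> b bL; rewrite (eq_bigr (fun j : 'I_n =>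
    (Num.min (P j.+1) (Q b.+1) - Num.min (P j.+1) (Q b))
    - (Num.min (P j) (Q b.+1) - Num.min (P j) (Q b)))) //.
  rewrite (telescope_ord (fun j => Num.min (P j) (Q b.+1) - Num.min (P j) (Q b))).
  rewrite EE P0.
  have h1 := Qm _ _ bL; have h2 := Qm _ _ (leq0n b); rewrite Q0 in h2.
  have h3 := le_trans h2 (Qm _ _ (leqnSn b)).
  rewrite (min_idPr h1) (min_idPr (le_trans (Qm _ _ (leqnSn b)) h1)).
  by rewrite (min_idPl h3) (min_idPl h2) !subr0 QS addrC addKr.
- move=> j b b' jn bL b'L Fb Fb'.
  case: small => [L1|small]; first by move: bL b'L; rewrite L1; case: b b' {Fb Fb'} => [|?] [|?].
  (* Otherwise item [j] begins before the end of bin [b] and ends after the start of [b'], so it is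
     longer than the bin [b.+1] in between. *)
  rewrite leqNgt; apply/negP => bb'.
  have h1 : P j < Q b.+1.
    by rewrite ltNge; apply/negP => h; case/eqP: Fb; apply: F0; right.
  have h2 : Q b' < P j.+1.
    by rewrite ltNge; apply/negP => h; case/eqP: Fb'; apply: F0; left.
  have b1L : (b.+1 < L)%N by apply: ltn_trans b'L.
  have h3 := le_lt_trans (Qm _ _ bb') h2.
  have h4 := small j b.+1 jn b1L.
  move: (ltr_leD h1 h4); rewrite -PS -QS => h5.
  by have := lt_trans h5 h3; rewrite ltxx.
Qed.

(* Sparse classes are spread over their first set; a dense class receives a
   fixed fraction of the remaining density [v], cut up along its walk. *)
Lemma multiscale_allocation (R : realFieldType) (A : finType) (u : A -> R)
    (n K : nat) (lam : nat -> R) (k : nat -> nat)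
    (L : nat -> nat) (S : nat -> nat -> {set A}) (eta beta : nat -> R) :
  let T := \sum_a u a in
  (forall a, 0 <= u a) -> 0 < T ->
  (forall j, 0 <= lam j) -> \sum_(j < n) lam j = T ->
  (forall j, (k j < K)%N) ->
  (forall c, 0 < L c)%N ->
  (forall c a, u a != 0 -> exists2 i, (i < L c)%N & a \in S c i) ->
  (forall c, 0 < eta c) -> \sum_(c < K) eta c <= 2^-1 ->
  (forall c, 0 < beta c) ->
  (forall c i, (i < L c)%N -> beta c <= \sum_(a in S c i) u a) ->
  (forall j, L (k j) = 1%N \/
     lam j <= eta (k j) * beta (k j) ^+ 2 / (2 * T * (L (k j))%:R)) ->
  exists f : nat -> A -> R,
    [/\ forall j a, 0 <= f j a,
        forall a, \sum_(j < n) f j a = u a,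
        forall j, (j < n)%N -> \sum_a f j a = lam j &
        forall j, (j < n)%N -> exists i, [/\ (i < L (k j))%N &
          forall a, f j a != 0 -> a \in S (k j) i \/
            ((i.+1 < L (k j))%N /\ a \in S (k j) i.+1)]].
Proof.
move=> T u0 T0 lam0 lamT kK L0 cov eta0 etaS beta0 betaS small.
pose us c i := \sum_(a in S c i) u a.
have us0 c i : (i < L c)%N -> 0 < us c i.
  by move=> iL; apply: lt_le_trans (betaS c i iL).
pose lamc c j := if k j == c then lam j else 0.
have lamc0 c j : 0 <= lamc c j by rewrite /lamc; case: ifP.
pose m c := \sum_(j < n) lamc c j.
have m0 c : 0 <= m c by apply: sumr_ge0.
have mT : \sum_(c < K) m c = T.
  rewrite -lamT exchange_big /=; apply: eq_bigr => j _.
  rewrite (bigD1 (Ordinal (kK j))) //= /lamc eqxx big1 ?addr0 // => i /negP ik.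
  by case: eqP => // e; case: ik; apply/eqP/val_inj.
(* Spread over its first set, a sparse class takes less than the fraction [eta c] of the density
   there; all sparse classes together therefore leave at least half of [u] on every atom. *)
pose sparse c := m c < eta c * us c 0%N.
pose hc c a := if a \in S c 0%N then m c / us c 0%N else 0.
pose h a := \sum_(c < K | sparse c) hc c a.
have hc0 c a : 0 <= hc c a.
  by rewrite /hc; case: ifP => // _; rewrite divr_ge0 // ltW // us0.
have h0 a : 0 <= h a by apply: sumr_ge0.
have hle a : h a <= 2^-1.
  apply: le_trans etaS; rewrite /h big_mkcond /=; apply: ler_sum => c _.
  case: ifP => [sp|_]; last exact: ltW.
  rewrite /hc; case: ifP => _; last exact: ltW.
  by rewrite ler_pdivrMr ?us0 // ltW.
pose v a := (1 - h a) * u a.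
have vge a : 2^-1 * u a <= v a.
  by rewrite /v ler_wpM2r //; have := hle a; lra.
have v0 a : 0 <= v a by apply: le_trans (vge a); rewrite mulr_ge0.
pose mD := \sum_(c < K | ~~ sparse c) m c.
have hcu c : \sum_a hc c a * u a = m c.
  rewrite (bigID (mem (S c 0%N))) /= [X in _ + X]big1 ?addr0; last first.
    by move=> a /negbTE aS; rewrite /hc aS mul0r.
  rewrite (eq_bigr (fun a => m c / us c 0%N * u a)); last first.
    by move=> a aS; rewrite /hc aS.
  by rewrite -mulr_sumr divfK // gt_eqF // us0.
have hu : \sum_a h a * u a = \sum_(c < K | sparse c) m c.
  under eq_bigr do rewrite /h mulr_suml.
  by rewrite exchange_big /=; apply: eq_bigr => c _; rewrite hcu.
have vT : \sum_a v a = mD.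
  under eq_bigr do rewrite /v mulrBl mul1r.
  by rewrite sumrB hu -/T -mT (bigID (fun c : 'I_K => sparse c)) /= /mD; ring.
have mD0 : 0 < mD.
  rewrite -vT; apply: lt_le_trans (ler_sum _ (fun a _ => vge a)).
  by rewrite -mulr_sumr mulr_gt0 // invr_gt0.
have mDT : mD <= T.
  rewrite -mT [leRHS](bigID (fun c : 'I_K => sparse c)) /= lerDr.
  exact: sumr_ge0.
(* The sets of a walk overlap and may repeat; dividing by the number of visits to [a] makes the
   shares of the bins add up to the density. *)
pose W c a := (\sum_(i < L c) (a \in S c i))%N.
have WL c a : (W c a <= L c)%N.
  rewrite /W; apply: (@leq_trans (\sum_(i < L c) 1)%N).
    by apply: leq_sum => i _; case: (_ \in _).
  by rewrite sum1_card card_ord.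
have W0 c a : u a != 0 -> (0 < W c a)%N.
  move=> /(cov c)[i iL aS].
  by rewrite /W (bigD1 (Ordinal iL)) //= aS.
(* What remains, [v], has exactly the total mass [mD] of the dense classes, so the fraction
   [m c / mD] of it gives class [c] its own mass and exhausts [v]. *)
pose nu c i a := m c / mD * (if a \in S c i then v a / (W c a)%:R else 0).
have nu0 c i a : 0 <= nu c i a.
  rewrite /nu mulr_ge0 ?divr_ge0 ?(ltW mD0) //; case: ifP => // _.
  by rewrite divr_ge0.
have nusum c a : \sum_(i < L c) nu c i a = m c / mD * v a.
  rewrite -mulr_sumr; congr (_ * _).
  have [ua|ua] := eqVneq (u a) 0.
    rewrite /v ua mulr0 big1 // => i _; case: ifP => // _.
    by rewrite mul0r.
  have -> : \sum_(i < L c) (if a \in S c i then v a / (W c a)%:R else 0)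
     = \sum_(i < L c) (v a / (W c a)%:R) * (a \in S c i)%:R.
    by apply: eq_bigr => i _; case: (_ \in _); rewrite ?mulr1 ?mulr0.
  rewrite -mulr_sumr -natr_sum -/(W c a) divfK // pnatr_eq0 -lt0n.
  exact: W0.
pose nut c i := \sum_a nu c i a.
have nut0 c i : 0 <= nut c i by apply: sumr_ge0.
have nutm c : ~~ sparse c -> \sum_(i < L c) nut c i = m c.
  move=> _; rewrite exchange_big /=; under eq_bigr do rewrite nusum.
  by rewrite -mulr_sumr vT divfK // gt_eqF.
(* Four bounds multiply: [m c >= eta c * beta c] by density of the class, [mD <= T], [v >= u / 2],
   and at most [L c] visits. This is the threshold in the smallness hypothesis. *)
have nutge c i : ~~ sparse c -> (i < L c)%N ->
    eta c * beta c ^+ 2 / (2 * T * (L c)%:R) <= nut c i.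
  rewrite /sparse -leNgt => sp iL.
  have Lc0 : 0 < (L c)%:R :> R by rewrite ltr0n.
  have mge : eta c * beta c <= m c.
    by apply: le_trans sp; rewrite ler_wpM2l ?(ltW (eta0 c)) // betaS.
  have s1 : \sum_(a in S c i) m c / T * (2^-1 * u a / (L c)%:R) <= nut c i.
    rewrite /nut big_mkcond /=; apply: ler_sum => a _.
    rewrite /nu; case: ifP => aS; last by rewrite mulr0.
    apply: ler_pM.
    - by rewrite divr_ge0 // ltW.
    - by rewrite divr_ge0 // mulr_ge0.
    - by rewrite ler_wpM2l // lef_pV2.
    have [ua|ua] := eqVneq (u a) 0.
      by rewrite ua mulr0 mul0r divr_ge0.
    apply: ler_pM; rewrite ?mulr_ge0 ?invr_ge0 //.
    by rewrite lef_pV2 ?posrE ?ltr0n ?W0 // ler_nat.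
  apply: le_trans s1; rewrite -mulr_sumr -mulr_suml -mulr_sumr.
  have -> : eta c * beta c ^+ 2 / (2 * T * (L c)%:R) =
     (eta c * beta c) / T * (2^-1 * beta c / (L c)%:R).
    by field; rewrite gt_eqF // gt_eqF.
  apply: ler_pM.
  - by rewrite divr_ge0 ?(ltW T0) // mulr_ge0 ?(ltW (eta0 c)) ?(ltW (beta0 c)).
  - by rewrite !mulr_ge0 ?invr_ge0 ?(ltW (beta0 c)).
  - by rewrite ler_wpM2r // invr_ge0 ltW.
  by rewrite ler_wpM2r ?invr_ge0 // ler_wpM2l ?invr_ge0 ?betaS.
have alloc c : exists F : nat -> nat -> R, ~~ sparse c ->
    [/\ forall j b, 0 <= F j b,
        forall j, (j < n)%N -> \sum_(b < L c) F j b = lamc c j,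
        forall b, (b < L c)%N -> \sum_(j < n) F j b = nut c b &
        forall j b b', (j < n)%N -> (b < L c)%N -> (b' < L c)%N ->
          F j b != 0 -> F j b' != 0 -> (b' <= b.+1)%N].
  have [sp|sp] := boolP (sparse c); first by exists (fun _ _ => 0).
  have [||||F HF] := @consecutive_allocation R n (L c) (lamc c) (nut c).
  - exact: lamc0.
  - exact: nut0.
  - by rewrite nutm.
  - have [L1|L1] := eqVneq (L c) 1%N; [by left|right => j b jn bL].
    (* Items of other classes have length 0 here and fit into any bin. *)
    rewrite /lamc; case: eqP => [e|_]; last exact: nut0.
    apply: le_trans (nutge _ _ sp bL).
    by case: (small j); rewrite e // => e'; rewrite e' in L1.
  by exists F.
have [F FP] := choice alloc.
(* The part of a dense item poured into bin [i] is distributed in proportion to the density [nu c i]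
   of that bin. *)
pose f j a := let c := k j in
  if sparse c then
    (if a \in S c 0%N then lam j / us c 0%N * u a else 0)
  else \sum_(i < L c) F c j i * (nu c i a / nut c i).
have FE c j i : ~~ sparse c -> (i < L c)%N -> (j < n)%N -> k j != c ->
  F c j i = 0.
  move=> sp iL jn kj; have [F0 F1 _ _] := FP c sp.
  have := F1 j jn; rewrite /lamc (negbTE kj) => /eqP.
  rewrite psumr_eq0 // => /allP /(_ (Ordinal iL)).
  by rewrite mem_index_enum => /(_ isT) /eqP.
have nutz c i a : nut c i = 0 -> nu c i a = 0.
  move/eqP; rewrite psumr_eq0 // => /allP /(_ a).
  by rewrite mem_index_enum => /(_ isT) /eqP.
exists f; split.
- move=> j a; rewrite /f /=; case: ifP => sp.
    case: ifP => // _; rewrite mulr_ge0 // divr_ge0 // ltW // us0 //.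
  have [F0 _ _ _] := FP _ (negbT sp).
  apply: sumr_ge0 => i _; apply: mulr_ge0; first exact: F0.
  by rewrite divr_ge0.
- move=> a.
  have -> : \sum_(j < n) f j a = \sum_(c < K) \sum_(j < n | k j == c) f j a.
    by rewrite (partition_big (fun j : 'I_n => Ordinal (kK j)) predT).
  rewrite (bigID (fun c : 'I_K => sparse c)) /=.
  have -> : \sum_(c < K | sparse c) \sum_(j < n | k j == c) f j a = h a * u a.
    rewrite /h mulr_suml; apply: eq_bigr => c sp.
    rewrite (eq_bigr (fun j : 'I_n => lam j *
        (if a \in S c 0%N then u a / us c 0%N else 0))); last first.
      move=> j /eqP kj; rewrite /f kj sp; case: ifP => _; last by rewrite mulr0.
      by rewrite mulrAC mulrA.
    rewrite -mulr_suml /hc /m /lamc -big_mkcond /=.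
    by case: ifP => _; rewrite ?mulr0 ?mul0r // mulrA mulrAC.
  have -> : \sum_(c < K | ~~ sparse c) \sum_(j < n | k j == c) f j a = v a.
    rewrite (eq_bigr (fun c : 'I_K => m c / mD * v a)); last first.
      move=> c sp; have [F0 F1 F2 _] := FP c sp.
      rewrite -nusum.
      rewrite (eq_bigr (fun j : 'I_n => \sum_(i < L c) F c j i * (nu c i a / nut c i)));
        last first.
        by move=> j /eqP kj; rewrite /f /= kj (negbTE sp).
      rewrite exchange_big /=; apply: eq_bigr => i _.
      rewrite -mulr_suml.
      have -> : \sum_(j < n | k j == c) F c j i = nut c i.
        rewrite -F2 // [RHS](bigID (fun j : 'I_n => k j == c)) /=.
        by rewrite [X in _ + X]big1 ?addr0 // => j kj; apply: FE.
      have [e|e] := eqVneq (nut c i) 0; last by rewrite mulrC divfK.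
      by rewrite e mul0r nutz.
    by rewrite -!mulr_suml -/mD divff ?mul1r // gt_eqF.
  by rewrite /v mulrBl mul1r addrC subrK.
- move=> j jn; rewrite /f /=; case: (boolP (sparse (k j))) => sp.
    rewrite -big_mkcond /= -mulr_sumr -/(us (k j) 0%N) divfK // gt_eqF // us0 //.
  have [F0 F1 F2 _] := FP _ sp.
  rewrite exchange_big /=.
  transitivity (lamc (k j) j); last by rewrite /lamc eqxx.
  rewrite -F1 //; apply: eq_bigr => i _.
  rewrite -mulr_sumr -mulr_suml -/(nut (k j) i).
  have [e|e] := eqVneq (nut (k j) i) 0; last by rewrite divff ?mulr1.
  rewrite e mul0r mulr0; move: e; rewrite -F2 // => /eqP.
  rewrite psumr_eq0 // => /allP /(_ (Ordinal jn)).
  by rewrite mem_index_enum => /(_ isT) /eqP.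
- move=> j jn; have [sp|sp] := boolP (sparse (k j)).
    exists 0%N; split=> // a; rewrite /f /= sp.
    by case: ifP => [aS _|_]; [left|rewrite eqxx].
  have [F0 F1 F2 F3] := FP _ sp.
  have [/existsP[i0 Fi0]|none] := boolP [exists i : 'I_(L (k j)), F (k j) j i != 0]; last first.
    exists 0%N; split=> // a; rewrite /f /= (negbTE sp) big1 ?eqxx // => i _.
    move: none; rewrite negb_exists => /forallP /(_ i).
    by rewrite negbK => /eqP ->; rewrite mul0r.
  have ex : exists i, (i < L (k j))%N && (F (k j) j i != 0).
    by exists i0; rewrite ltn_ord.
  (* From the least bin that the item meets, adjacency allows only this bin and the next one. *)
  case: (ex_minnP ex) => i /andP[iL Fi] imin.
  exists i; split=> // a; rewrite /f /= (negbTE sp) => fa.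
  have [i1 Fi1] : exists i1 : 'I_(L (k j)),
      F (k j) j i1 * (nu (k j) i1 a / nut (k j) i1) != 0.
    apply/existsP; apply: contraNT fa; rewrite negb_exists => /forallP fa.
    by rewrite big1 // => i1 _; apply/eqP; move: (fa i1); rewrite negbK.
  move: Fi1; rewrite !mulf_eq0 !negb_or => /andP[Fi1 /andP[/andP[_]]].
  case: ifP => [aS _ _|_]; last by rewrite eqxx.
  have l1 : (i <= i1)%N by apply: imin; rewrite ltn_ord.
  have l2 : (i1 <= i.+1)%N by apply: F3 Fi Fi1.
  move: l1; rewrite leq_eqVlt => /orP[/eqP e|l1]; first by left; rewrite e.
  have e : i1 = i.+1 :> nat by apply/eqP; rewrite eqn_leq l2 l1.
  by right; rewrite -e ltn_ord.
Qed.

(** * Realization by measurable sets *)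

Section atomless.
Context d (T : measurableType d) (R : realType) (mu : {measure set T -> \bar R}).

(* Arbitrarily fine finite covers stand in for the absence of atoms. *)
Definition finely_coverable := forall e : R, 0 < e ->
  exists (N : nat) (C : nat -> set T),
    [/\ forall i, measurable (C i),
        forall x, exists2 i, (i < N)%N & C i x &
        forall i, (i < N)%N -> (mu (C i) <= e%:E)%E].

Hypothesis fine_covers : finely_coverable.

(** Add the pieces of a cover by sets of measure at most [e] one after the other. Just before the
    measure first exceeds [t] it is within [e] of [t]; if it never does, [E] itself has measure
    [t]. *)
Lemma measure_approach (E F0 : set T) (t e : R) :
  measurable E -> measurable F0 -> F0 `<=` E ->
  (mu F0 <= t%:E)%E -> (t%:E <= mu E)%E -> 0 < e ->
  exists F, [/\ measurable F, F0 `<=` F, F `<=` E,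
    (mu F <= t%:E)%E & (t%:E <= mu F + e%:E)%E].
Proof.
move=> mE mF0 F0E F0t tE e0.
have [N [C [mC CT Ce]]] := fine_covers e0.
pose G m := F0 `|` (E `&` \bigcup_(i in `I_m) C i).
have mG m : measurable (G m).
  by apply: measurableU => //; apply: measurableI => //; apply: bigcup_measurable.
have GE m : G m `<=` E by move=> x [/F0E|[]].
have [//|none] := pselect (exists F, [/\ measurable F, F0 `<=` F, F `<=` E,
    (mu F <= t%:E)%E & (t%:E <= mu F + e%:E)%E]).
have Gt m : (m <= N)%N -> (mu (G m) <= t%:E)%E.
  elim: m => [_|m IH mN].
    by rewrite /G II0 bigcup_set0 setI0 setU0.
  have {}IH := IH (ltnW mN); rewrite leNgt; apply/negP => tG; apply: none.
  exists (G m); split => //; first by move=> x; left.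
  apply: le_trans (ltW tG) _.
  apply: (@le_trans _ _ (mu (G m `|` C m))).
    apply: le_measure; rewrite ?inE //; first exact: measurableU.
    move=> x [F0x|[Ex [i /= im Cix]]]; first by left; left.
    move: im; rewrite ltnS leq_eqVlt => /orP[/eqP im|im]; first by right; rewrite -im.
    by left; right; split => //; exists i.
  by apply: le_trans (measureU2 _ _ _) _ => //; rewrite leeD2l // Ce.
have GN : G N = E.
  apply/seteqP; split; first exact: GE.
  by move=> x Ex; right; split => //; have [i iN Cx] := CT x; exists i.
exists E; split => //; first by rewrite -GN Gt.
by apply: le_trans tE _; rewrite leeDl // lee_fin ltW.
Qed.

(** Sierpinski's theorem that an atomless measure takes all intermediate values: approach [t] from
    below by an increasing sequence with errors [1 / (k + 1)] and take the union. *)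
Lemma measure_split (E : set T) (t : R) :
  measurable E -> 0 <= t -> (t%:E <= mu E)%E ->
  exists F, [/\ measurable F, F `<=` E & mu F = t%:E].
Proof.
move=> mE t0 tE.
pose good (F : set T) := [/\ measurable F, F `<=` E & (mu F <= t%:E)%E].
have step (F : set T) (k : nat) : exists G, good F ->
    [/\ good G, F `<=` G & (t%:E <= mu G + (k.+1%:R^-1)%:E)%E].
  have [gF|nF] := pselect (good F); last by exists F.
  case: gF => mF FE Ft.
  have k0 : 0 < k.+1%:R^-1 :> R by [].
  have [G [mG FG GE Gt tG]] := measure_approach mE mF FE Ft tE k0.
  by exists G.
have [next nextP] := choice (fun p : set T * nat => step p.1 p.2).
pose Fs := fix Fs k := if k is k'.+1 then next (Fs k', k') else set0.
have Fg k : good (Fs k).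
  elim: k => [|k IH] /=; first by split; rewrite ?measure0 ?lee_fin.
  by have [] := nextP (Fs k, k) IH.
have Fm : nondecreasing_seq Fs.
  apply/nondecreasing_seqP => k; apply/subsetPset.
  by have [] := nextP (Fs k, k) (Fg k).
have mF : measurable (\bigcup_k Fs k).
  by apply: bigcup_measurable => k _; have [] := Fg k.
have := nondecreasing_cvg_mu (mu := mu) (fun k => let: And3 m _ _ := Fg k in m) mF Fm.
move=> cv; exists (\bigcup_k Fs k); split => //.
  by move=> x [k _]; have [_ + _] := Fg k; apply.
apply/eqP; rewrite eq_le; apply/andP; split.
  rewrite -(cvg_lim _ cv) //; apply: lime_le; first by apply/cvg_ex; eexists; exact: cv.
  by apply: nearW => k /=; have [] := Fg k.
apply/lee_addgt0Pr => e e0.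
have [k ke] : exists k : nat, k.+1%:R^-1 <= e.
  exists (Num.truncn e^-1); rewrite invf_ple ?posrE //.
  by apply/ltW/truncnS_gt.
have [_ _ h] := nextP (Fs k, k) (Fg k).
apply: le_trans h _; apply: leeD; last by rewrite lee_fin.
apply: le_measure; rewrite ?inE //; first by have [] := Fg k.+1.
by move=> x Fx; exists k.+1.
Qed.

Lemma measure_split_seq (n : nat) (w : nat -> R) (E : set T) :
  measurable E -> (forall j, 0 <= w j) -> ((\sum_(j < n) w j)%:E <= mu E)%E ->
  exists Y : nat -> set T, [/\ forall j, measurable (Y j), forall j, Y j `<=` E,
    forall j, (j < n)%N -> mu (Y j) = (w j)%:E &
    forall i j x, (i < n)%N -> (j < n)%N -> Y i x -> Y j x -> i = j].
Proof.
move=> + w0; elim: n E => [|n IH] E mE.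
  by move=> _; exists (fun=> set0); split=> // ? ? ?.
rewrite big_ord_recr /= => wE.
have s0 : 0 <= \sum_(j < n) w j by apply: sumr_ge0.
have [||F [mF FE muF]] := @measure_split E (\sum_(j < n) w j) mE.
- exact: s0.
- by apply: le_trans wE; rewrite lee_fin lerDl.
have [||G [mG GE muG]] := @measure_split (E `\` F) (w n) (measurableD mE mF).
- exact: w0.
- have e : (mu E = mu (E `\` F) + mu F)%E.
    by rewrite (measureDI mu mE mF) setIidr.
  move: wE; rewrite e muF addeC EFinD.
  by rewrite leeD2lE.
have [|Y [mY YF muY dY]] := IH F mF; first by rewrite muF.
exists (fun j => if (j < n)%N then Y j else G); split.
- by move=> j; case: ifP.
- by move=> j; case: ifP => _ x; [move/YF/FE|move/GE => -[]].
- move=> j; rewrite ltnS leq_eqVlt => /orP[/eqP ->|jn]; first by rewrite ltnn.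
  by rewrite jn muY.
- move=> i j x; rewrite !ltnS => il jl.
  have [ni|ni] := ltnP i n; have [nj|nj] := ltnP j n.
  + exact: dY.
  + by move=> /YF Fx /GE[].
  + by move=> /GE[_ Fx] /YF.
  by move=> _ _; apply/eqP; rewrite eqn_leq (leq_trans il nj) (leq_trans jl ni).
Qed.

Lemma measure_finite_partition (A : finType) (Y : A -> set T) :
  (forall a, measurable (Y a)) -> (forall a b x, Y a x -> Y b x -> a = b) ->
  mu (\bigcup_a Y a) = (\sum_a mu (Y a))%E.
Proof.
move=> mY dY.
have tY : trivIset setT Y by move=> a b _ _ [x [Yax Ybx]]; exact: dY Yax Ybx.
rewrite (measure_fin_bigcup mu (@finite_finset A setT) tY (fun a _ => mY a)).
have := @fsbig_seq _ _ +%E A (enum A) (mu \o Y) (enum_uniq A).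
rewrite big_enum /= => ->.
by apply: eq_fsbigl; apply/seteqP; split => a /= _; rewrite ?mem_enum.
Qed.

(** The fibres of [sig] are the atoms on which the densities are constant; each of them is cut into
    pieces of the prescribed measures independently of the others. *)
Lemma realize_fractions (A : finType) (sig : T -> A) (n : nat)
    (f : nat -> A -> R) :
  (forall a, measurable (sig @^-1` [set a])) ->
  (forall j a, 0 <= f j a) ->
  (forall a, (\sum_(j < n) f j a)%:E = mu (sig @^-1` [set a])) ->
  exists Y : nat -> set T, [/\ forall j, measurable (Y j),
    forall j, (j < n)%N -> mu (Y j) = (\sum_a f j a)%:E,
    forall i j x, (i < n)%N -> (j < n)%N -> Y i x -> Y j x -> i = j &
    forall j x, Y j x -> f j (sig x) != 0].
Proof.
move=> msig f0 fE.
have ex a : exists Y : nat -> set T, [/\ forall j, measurable (Y j),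
    forall j, Y j `<=` sig @^-1` [set a],
    forall j, (j < n)%N -> mu (Y j) = (f j a)%:E &
    forall i j x, (i < n)%N -> (j < n)%N -> Y i x -> Y j x -> i = j].
  by apply: measure_split_seq => //; rewrite fE.
have [Y YP] := choice ex.
(* A piece of measure 0 need not be empty; dropping it gives the support condition of the last
   conclusion. *)
pose Z j a := if f j a != 0 then Y a j else set0.
have mZ j a : measurable (Z j a).
  by rewrite /Z; case: ifP => // _; have [] := YP a.
have Zsig j a x : Z j a x -> sig x = a.
  by rewrite /Z; case: ifP => // _; have [_ + _ _] := YP a; move/(_ j x).
exists (fun j => \bigcup_a Z j a); split.
- by move=> j; apply: fin_bigcup_measurable => //; exact: finite_finset.
- move=> j jn; rewrite measure_finite_partition //; last first.
    by move=> a b x /Zsig <- /Zsig.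
  rewrite -sumEFin; apply: eq_bigr => a _; rewrite /Z.
  have [-> | fa] := eqVneq (f j a) 0; first by rewrite measure0.
  by have [_ _ -> ] := YP a.
- move=> i j x iln jn [a _ Zi] [b _ Zj].
  have e : a = b by rewrite -(Zsig _ _ _ Zi) (Zsig _ _ _ Zj).
  rewrite -{}e /Z in Zj Zi *; move: Zi Zj; case: ifP => // _; case: ifP => // _.
  by have [_ _ _] := YP a; apply.
- move=> j x [a _ Zx]; rewrite (Zsig _ _ _ Zx).
  by move: Zx; rewrite /Z; case: ifP.
Qed.

End atomless.

Lemma full_partition_null d (T : measurableType d) (R : realType)
    (mu : {measure set T -> \bar R}) (n : nat) (lam : 'I_n -> R)
    (Y : 'I_n -> set T) :
  (forall j, measurable (Y j)) -> (forall j, mu (Y j) = (lam j)%:E) ->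
  (forall i j x, Y i x -> Y j x -> i = j) ->
  mu setT = (\sum_j lam j)%:E ->
  mu (~` \bigcup_j Y j) = 0.
Proof.
move=> mY muY dY muT.
have mU : measurable (\bigcup_j Y j).
  by apply: fin_bigcup_measurable => //; exact: finite_finset.
have muU : mu (\bigcup_j Y j) = (\sum_j lam j)%:E.
  rewrite measure_finite_partition // -sumEFin.
  by apply: eq_bigr => j _; rewrite muY.
have e : (mu setT = mu (~` \bigcup_j Y j) + mu (\bigcup_j Y j))%E.
  by rewrite (measureDI mu measurableT mU) setTI setTD.
have := congr1 (fun z => z - mu (\bigcup_j Y j))%E e.
by rewrite muT muU addeK // subee.
Qed.

(** The points missed by all [Y j] form a null set, so they may be moved freely: each goes to the
    first [j] with [B j] containing it, [V j] being the union of the earlier ones. *)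
Lemma absorb_null_part d (T : measurableType d) (R : realType)
    (mu : {measure set T -> \bar R}) (n : nat) (lam : 'I_n -> R)
    (Y B : 'I_n -> set T) :
  (forall j, measurable (Y j)) -> (forall j, measurable (B j)) ->
  (forall j, mu (Y j) = (lam j)%:E) ->
  (forall i j x, Y i x -> Y j x -> i = j) ->
  mu setT = (\sum_j lam j)%:E ->
  (forall j, Y j `<=` B j) -> (forall x, exists j, B j x) ->
  exists X : 'I_n -> set T,
    [/\ forall j, measurable (X j), \bigcup_j X j = setT,
        trivIset setT X, forall j, mu (X j) = (lam j)%:E &
        forall j, X j `<=` B j].
Proof.
move=> mY mB muY dY muT YB BT.
pose U := \bigcup_j Y j; pose V (j : 'I_n) := \bigcup_(i in [set i : 'I_n | (i < j)%N]) B i.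
have mU : measurable U by apply: fin_bigcup_measurable => //; exact: finite_finset.
have mV j : measurable (V j) by apply: fin_bigcup_measurable => //; exact: finite_finset.
have U0 := full_partition_null mY muY dY muT; rewrite -/U in U0.
exists (fun j => Y j `|` ((~` U `&` B j) `\` V j)); split.
- move=> j; apply: measurableU => //; apply: measurableD => //.
  by apply: measurableI => //; exact: measurableC.
- apply/seteqP; split => // x _.
  have [[j _ Yx]|nU] := pselect (U x); first by exists j => //; left.
  have [j0 Bj0] := BT x.
  case: (@arg_minnP 'I_n j0 (fun i => `[< B i x >]) val (asboolT Bj0)) => j /asboolP Bj jmin.
  exists j => //; right; split => // -[i /= ij Bi].
  by have := jmin i (asboolT Bi); rewrite leqNgt ij.
- move=> i j _ _ [x []].
  case=> [Yi|[[nU Bi] nVi]] [Yj|[[nU' Bj] nVj]].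
  + exact: dY Yi Yj.
  + by case: nU'; exists i.
  + by case: nU; exists j.
  case: (ltngtP i j) => [ij|ji|/ord_inj //]; exfalso.
    by apply: nVj; exists i.
  by apply: nVi; exists j.
- move=> j.
  have mZ : measurable ((~` U `&` B j) `\` V j).
    by apply: measurableD => //; apply: measurableI => //; exact: measurableC.
  have Z0 : mu ((~` U `&` B j) `\` V j) = 0.
    apply: (subset_measure0 mZ (measurableC mU) _ U0).
    by move=> x [[]].
  have YZ : Y j `&` ((~` U `&` B j) `\` V j) = set0.
    by apply/seteqP; split => // x [Yx [[nU _] _]]; case: nU; exists j.
  transitivity (mu (Y j) + mu ((~` U `&` B j) `\` V j))%E.
    exact: measureU.
  by rewrite muY Z0 adde0.
- by move=> j x [/YB|[[]]].
Qed.

(** * Walks and the decomposition of regular spaces *)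

(** Openness refers to the given topology of [X]: it makes balls Borel and lets connectedness act on
    nets. Infinite distances and distinct points at distance 0 are allowed. *)
Record ball_system (R : realType) (X : topologicalType) (rho : X -> X -> \bar R) :
    Prop := BallSystem {
  ball_system_refl : forall x, rho x x = 0%E;
  ball_system_ge0 : forall x y, (0 <= rho x y)%E;
  ball_system_sym : forall x y, rho x y = rho y x;
  ball_system_triangle : forall x y z, (rho x z <= rho x y + rho y z)%E;
  ball_system_open : forall x r, open (dball rho x r) }.

Section walks.
Context (R : realType) (X : ptopologicalType) (rho : X -> X -> \bar R).
Hypothesis bs : ball_system rho.

Lemma dball_center (x : X) (r : R) : 0 < r -> dball rho x r x.
Proof. by move=> r0; rewrite /dball /= (ball_system_refl bs) lte_fin. Qed.

Lemma dball_sym (x y : X) (r : R) : dball rho x r y -> dball rho y r x.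
Proof. by rewrite /dball /= (ball_system_sym bs). Qed.

Lemma dball_triangle (x y z : X) (r s : R) :
  dball rho x r y -> dball rho y s z -> dball rho x (r + s) z.
Proof.
rewrite /dball /= => xy yz; apply: le_lt_trans (ball_system_triangle bs x y z) _.
by rewrite EFinD; apply: lteD.
Qed.

Lemma dball_subset (x : X) (r s : R) : r <= s -> dball rho x r `<=` dball rho x s.
Proof. by move=> rs y; rewrite /dball /= => /lt_le_trans; apply; rewrite lee_fin. Qed.

Lemma measurable_dball (x : X) (r : R) : measurable (dball rho x r : set (borel X)).
Proof. by apply: sub_sigma_algebra; exact: ball_system_open. Qed.

Hypothesis conX : connected [set: X].
Variables (mu : {measure set (borel X) -> \bar R}) (T : R).
Hypothesis muT : mu setT = T%:E.

Definition separated (delta : R) (N : nat) (p : nat -> X) :=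
  forall i j, (i < j < N)%N -> ~ dball rho (p i) delta (p j).

(** By the triangle inequality the balls of half the radius are disjoint, so their measures add up
    to at most [T]. *)
Lemma packing_bound (delta beta : R) (N : nat) (p : nat -> X) :
  0 < delta -> (forall x, (beta%:E <= mu (dball rho x (delta / 2)))%E) ->
  separated delta N p -> N%:R * beta <= T.
Proof.
move=> d0 betaP sep.
pose Y (i : 'I_N) : set (borel X) := dball rho (p i) (delta / 2).
have mY i : measurable (Y i) by exact: measurable_dball.
have disj (i j : 'I_N) x : (i < j)%N -> Y i x -> Y j x -> False.
  move=> ij Yi /dball_sym Yj; apply: (sep i j); first by rewrite ij /=.
  by have := dball_triangle Yi Yj; rewrite -splitr.
have dY i j x : Y i x -> Y j x -> i = j.
  by move=> Yi Yj; case: (ltngtP i j) => [ij|ij|/ord_inj //]; exfalso;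
    [apply: disj ij Yi Yj|apply: disj ij Yj Yi].
rewrite -lee_fin -muT.
apply: (@le_trans _ _ (mu (\bigcup_i Y i))); last first.
  apply: le_measure; rewrite ?inE //.
  by apply: fin_bigcup_measurable => //; exact: finite_finset.
rewrite measure_finite_partition //.
apply: (@le_trans _ _ (\sum_(i < N) beta%:E)%E).
  by rewrite sumEFin sumr_const card_ord mulr_natl.
by apply: lee_sum => i _; exact: betaP.
Qed.

(** The packing bound limits the size of separated families, and one of maximal size is a net. *)
Lemma net_exists (delta beta : R) : 0 < delta -> 0 < beta ->
  (forall x, (beta%:E <= mu (dball rho x (delta / 2)))%E) ->
  exists (N : nat) (p : nat -> X), N%:R * beta <= T /\
    forall x, exists2 i, (i < N)%N & dball rho (p i) delta x.
Proof.
move=> d0 b0 betaP.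
pose P N := `[< exists p, separated delta N p >].
have P0 : exists N, P N by exists 0%N; apply/asboolP; exists (fun=> point) => i j; rewrite andbF.
have Pb N : P N -> (N <= Num.truncn (T / beta))%N.
  move=> /asboolP[p /(packing_bound d0 betaP) h].
  have Tb : N%:R <= T / beta by rewrite ler_pdivlMr.
  by rewrite truncn_ge_nat // (le_trans _ Tb).
case: (ex_maxnP P0 Pb) => N /asboolP[p sep] Nmax.
exists N, p; split; first exact: packing_bound sep.
move=> x; apply: contrapT => nx.
suff /Nmax : P N.+1 by rewrite ltnn.
(* Appended at the end, [x] only has to avoid the balls about the earlier points, because
   [separated] is stated for [i < j]. *)
apply/asboolP; exists (fun i => if (i < N)%N then p i else x) => i j /andP[ij].
rewrite ltnS leq_eqVlt => /orP[/eqP jN|jN].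
  by rewrite -jN ij jN ltnn => h; apply: nx; exists i => //; rewrite -jN.
by rewrite jN (ltn_trans ij jN); apply: sep; rewrite ij.
Qed.

(** From the end of the walk built so far, append a simple path to the next vertex of the list. A
    simple path has at most [#|V|] vertices, whence the quadratic bound. *)
Lemma visiting_path (V : finType) (e : rel V) (x0 : V) :
  (forall x y, connect e x y) ->
  exists q, [/\ path e x0 q, forall x, x \in x0 :: q & (size q <= #|V| * #|V|)%N].
Proof.
move=> con.
suff h (s : seq V) : exists q, [/\ path e x0 q, {subset s <= x0 :: q} &
    (size q <= size s * #|V|)%N].
  have [q [pq sq zq]] := h (enum V); exists q; split => //.
    by move=> x; apply: sq; rewrite mem_enum.
  by move: zq; rewrite -cardE.
elim: s => [|x s [q [pq sq zq]]]; first by exists [::].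
have /connectP[r pr rx] := con (last x0 q) x.
move: rx; case: (shortenP pr) => r' pr' ur' _ rx.
exists (q ++ r'); split.
- by rewrite cat_path pq.
- move=> y; rewrite inE => /orP[/eqP ->|/sq].
    by rewrite rx -last_cat mem_last.
  by rewrite !inE mem_cat orbA => ->.
rewrite size_cat mulSn addnC leq_add //.
have := card_uniqP ur' => /= c.
by apply: leq_trans (leqnSn _) _; rewrite -c max_card.
Qed.

(** The walk runs in the graph on a [delta]-net whose edges join points less than [2 * delta] apart.
    The net has at most [T / beta] points, and the walk visits each of them. *)
Lemma walk_exists (delta beta : R) : 0 < delta -> 0 < beta ->
  (forall x, (beta%:E <= mu (dball rho x (delta / 2)))%E) ->
  exists (L : nat) (w : nat -> X),
    [/\ (0 < L)%N, L%:R <= 1 + (T / beta) ^+ 2,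
        forall i, (i.+1 < L)%N -> dball rho (w i) (2 * delta) (w i.+1) &
        forall x, exists2 i, (i < L)%N & dball rho (w i) delta x].
Proof.
move=> d0 b0 betaP.
have [N [p [NT cov]]] := net_exists d0 b0 betaP.
pose e (i j : 'I_N) := `[< dball rho (p i) (2 * delta) (p j) >].
have overlap (i j : 'I_N) x :
    dball rho (p i) delta x -> dball rho (p j) delta x -> e i j.
  move=> ix /dball_sym xj; apply/asboolP; rewrite mulr_natl mulr2n.
  exact: dball_triangle ix xj.
have con i j : connect e i j.
  (* The balls about the net points reachable from [i] and those about the others have disjoint open
     unions, since balls that meet have adjacent centres. These unions cover [X], so connectedness
     leaves only the first. *)
  pose U := \bigcup_(k in [set k | connect e i k]) dball rho (p k) delta.
  pose V := \bigcup_(k in [set k | ~~ connect e i k]) dball rho (p k) delta.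
  have opU : open U by apply: bigcup_open => k _; exact: ball_system_open.
  have opV : open V by apply: bigcup_open => k _; exact: ball_system_open.
  have UV x : U x -> V x -> False.
    move=> [k /= ik kx] [l /= /negP il lx]; apply: il.
    by apply: connect_trans ik _; apply/connect1/(overlap _ _ x).
  have UVT x : U x \/ V x.
    have [k kN kx] := cov x.
    have [ik|ik] := boolP (connect e i (Ordinal kN)).
      by left; exists (Ordinal kN).
    by right; exists (Ordinal kN).
  have UT : U = setT.
    apply: conX.
    - by exists (p i); exists i => //=; exact: dball_center.
    - by exists U => //; rewrite setTI.
    - exists (~` V); first exact: open_closedC.
      rewrite setTI; apply/seteqP; split => x; first by move=> Ux Vx; exact: UV Ux Vx.
      by case: (UVT x).
  apply: contrapT => /negP ij; apply: (@UV (p j)); first by rewrite UT.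
  by exists j => //; exact: dball_center.
have [i0 i0N _] := cov point.
have [q [pq qV zq]] := visiting_path (Ordinal i0N) con.
exists (size q).+1, (fun i => p (nth (Ordinal i0N) (Ordinal i0N :: q) i)); split => //.
- rewrite -[X in X%:R <= _]add1n natrD lerD2l.
  apply: (@le_trans _ _ (N%:R ^+ 2)).
    by rewrite -natrX ler_nat -mulnn; move: zq; rewrite card_ord.
  rewrite lerXn2r ?nnegrE ?divr_ge0 ?(ltW b0) //; last by rewrite ler_pdivlMr.
  by apply: le_trans NT; rewrite mulr_ge0 // ltW.
- move=> i iq; have := pathP (Ordinal i0N) pq i iq.
  by move=> /asboolP.
- move=> x; have [k kN kx] := cov x.
  exists (index (Ordinal kN) (Ordinal i0N :: q)).
    by have := qV (Ordinal kN); rewrite -index_mem.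
  by rewrite nth_index.
Qed.

Lemma walk_diameter (delta : R) (L : nat) (w : nat -> X) :
  0 < delta -> (forall i, (i.+1 < L)%N -> dball rho (w i) (2 * delta) (w i.+1)) ->
  (forall x, exists2 i, (i < L)%N & dball rho (w i) delta x) ->
  forall x y, dball rho x (4 * delta * (L.+1)%:R) y.
Proof.
move=> d0 step cov.
have reach i : (i < L)%N -> dball rho (w 0%N) (2 * delta * i.+1%:R) (w i).
  elim: i => [|i IH] iL; first by apply: dball_center; rewrite !mulr_gt0.
  have := dball_triangle (IH (ltnW iL)) (step _ iL).
  by rewrite -[i.+2]addn1 natrD mulrDr mulr1.
have near0 x : dball rho (w 0%N) (2 * delta * L.+1%:R) x.
  have [i iL ix] := cov x; apply: dball_subset (dball_triangle (reach i iL) ix).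
  rewrite -[L.+1]addn1 natrD mulrDr mulr1 lerD //.
    by rewrite ler_wpM2l ?ler_nat // mulr_ge0 // ltW.
  by rewrite mulr_natl mulr2n lerDl ltW.
move=> x y; apply: dball_subset (dball_triangle (dball_sym (near0 x)) (near0 y)).
by rewrite -mulrDl -mulrDl -natrD.
Qed.

Variables (s a Delta : R).
Hypotheses (a0 : 0 < a) (Delta0 : 0 < Delta).
Hypothesis lower : forall x r, 0 < r -> r <= Delta ->
  ((a * r `^ s)%:E <= mu (dball rho x r))%E.

(* With a nonpositive exponent the number of net points stays bounded as the
   scale tends to zero, and a walk through them shows that the diameter is 0. *)
Lemma regular_exponent_gt0 (x y : X) : (0 < rho x y)%E -> 0 < s.
Proof.
move=> xy; rewrite ltNge; apply/negP => s0.
have T0 : 0 <= T by rewrite -lee_fin -muT.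
pose B := (1 + (T / a) ^+ 2 + 1) * 4.
have B0 : 0 < B.
  by rewrite mulr_gt0 // ltr_wpDl // addr_ge0 // exprn_ge0 // divr_ge0 // ltW.
suff h (e : R) : 0 < e -> (rho x y <= e%:E)%E.
  suff : (rho x y <= 0)%E by rewrite leNgt xy.
  by apply/lee_addgt0Pr => e e0; rewrite add0e h.
move=> e0; pose delta := Num.min (Num.min 1 Delta) (e / B).
have d0 : 0 < delta by rewrite !lt_min ltr01 Delta0 divr_gt0.
have d1 : delta <= 1 by rewrite /delta !ge_min lexx.
have dD : delta <= Delta by rewrite /delta !ge_min lexx orbT.
have de : delta <= e / B by rewrite /delta !ge_min lexx !orbT.
(* For [s <= 0] and radii at most 1 the power is at least 1, so [a] bounds the measure of balls from
   below at every small scale, and the bound on the number of steps is independent of [delta]. *)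
have betaP z : (a%:E <= mu (dball rho z (delta / 2)))%E.
  have h0 : 0 < delta / 2 by rewrite divr_gt0.
  have hle : delta / 2 <= delta by rewrite ler_pdivrMr // ler_peMr ?(ltW d0) // ler1n.
  apply: le_trans (lower z h0 (le_trans hle dD)).
  rewrite lee_fin ler_pMr //.
  by rewrite -[leLHS](powRr0 (delta / 2)) ger_powR ?h0 /= ?(le_trans hle).
have [L [w [L0 LB step cov]]] := walk_exists d0 a0 betaP.
apply: le_trans (ltW (walk_diameter d0 step cov x y)) _.
rewrite lee_fin mulrAC.
apply: (@le_trans _ _ (B * delta)).
  by rewrite ler_wpM2r ?(ltW d0) // /B mulrC ler_wpM2r // -[L.+1]addn1 natrD lerD2r.
by rewrite mulrC -ler_pdivlMr.
Qed.

End walks.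

Lemma measure_fibres d (T : measurableType d) (R : realType)
    (mu : {measure set T -> \bar R}) (A : finType) (sig : T -> A) (P : pred A) :
  (forall a, measurable (sig @^-1` [set a])) ->
  mu [set x | P (sig x)] = (\sum_(a | P a) mu (sig @^-1` [set a]))%E.
Proof.
move=> msig; pose Y a := if P a then sig @^-1` [set a] else set0.
have -> : [set x | P (sig x)] = \bigcup_a Y a.
  apply/seteqP; split => x /=; first by move=> Px; exists (sig x) => //; rewrite /Y Px.
  by move=> [a _]; rewrite /Y; case: ifP => // Pa /= ->.
rewrite measure_finite_partition.
- rewrite [RHS]big_mkcond /=; apply: eq_bigr => a _.
  by rewrite /Y; case: ifP => // _; rewrite measure0.
- by move=> a; rewrite /Y; case: ifP.
- by move=> a b x; rewrite /Y; case: ifP => // _ <-; case: ifP.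
Qed.

(** The fibre over [a] consists of the points with membership pattern [a]: the fibres are the atoms
    of the finite algebra generated by the [S i]. *)
Lemma measurable_signature d (T : measurableType d) (I : finType) (S : I -> set T) :
  (forall i, measurable (S i)) -> forall a : {set I},
  measurable ((fun x => [set i | `[< S i x >]]%SET) @^-1` [set a]).
Proof.
move=> mS a; have -> : (fun x => [set i | `[< S i x >]]%SET) @^-1` [set a] =
    \bigcap_i (if i \in a then S i else ~` S i).
  apply/seteqP; split => x /=.
    move=> e i _; have -> : (i \in a) = `[< S i x >] by rewrite -e inE.
    by case: asboolP.
  move=> h; apply/setP => i; rewrite inE; have := h i Logic.I.
  by case: ifP => _ Sx; [rewrite asboolT|rewrite asboolF].
apply: fin_bigcap_measurable; first exact: finite_finset.
by move=> i _; case: ifP => // _; exact: measurableC.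
Qed.

(** * From walks at several scales to a measurable partition *)

Section decomposition_of_walks.
Context (R : realType) (X : ptopologicalType) (rho : X -> X -> \bar R).
Hypothesis bs : ball_system rho.
Variables (mu : {measure set (borel X) -> \bar R}) (T : R).
Hypotheses (muT : mu setT = T%:E) (T0 : 0 < T).
Hypothesis fine_covers : finely_coverable mu.
Hypothesis ball_gt0 : forall x (r : R), 0 < r -> (0 < mu (dball rho x r))%E.

(** The sets [S c i] in a finite range of indices generate a finite algebra. The measures of its
    atoms are the weights fed to [multiscale_allocation], and the resulting densities are realized
    inside the atoms. *)
Lemma decomposition_of_walks (n K : nat) (lam : nat -> R) (k : nat -> nat)
    (L : nat -> nat) (S : nat -> nat -> set (borel X)) (eta beta : nat -> R)
    (ctr : nat -> nat -> X) (rad : nat -> R) :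
  (forall j, 0 <= lam j) -> \sum_(j < n) lam j = T ->
  (forall j, (k j < K)%N) -> (forall c, 0 < L c)%N ->
  (forall c i, measurable (S c i)) ->
  (forall c x, exists2 i, (i < L c)%N & S c i x) ->
  (forall c, 0 < eta c) -> \sum_(c < K) eta c <= 2^-1 ->
  (forall c, 0 < beta c) ->
  (forall c i, (i < L c)%N -> ((beta c)%:E <= mu (S c i))%E) ->
  (forall j, L (k j) = 1%N \/
     lam j <= eta (k j) * beta (k j) ^+ 2 / (2 * T * (L (k j))%:R)) ->
  (forall c, 0 < rad c) ->
  (forall c i, (i < L c)%N -> S c i `<=` dball rho (ctr c i) (rad c)) ->
  (forall c i, (i.+1 < L c)%N -> S c i.+1 `<=` dball rho (ctr c i) (rad c)) ->
  exists Y : 'I_n -> set (borel X),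
    [/\ forall j, measurable (Y j), \bigcup_j Y j = setT,
        trivIset setT Y, forall j, mu (Y j) = (lam j)%:E &
        forall j : 'I_n, exists x, Y j `<=` dball rho x (2 * rad (k j))].
Proof.
move=> lam0 lamT kK L0 mS cov eta0 etaS beta0 betaS small rad0 ctr0 ctr1.
pose M := (\sum_(c < K) L c)%N.
have LM c i : (c < K)%N -> (i < L c)%N -> (i < M)%N.
  move=> cK iL; apply: leq_trans iL _.
  by rewrite /M (bigD1 (Ordinal cK)) //= leq_addr.
pose SS (p : 'I_K * 'I_M) := S p.1 p.2.
pose sig (x : borel X) := [set p | `[< SS p x >]]%SET.
have msig a : measurable (sig @^-1` [set a]).
  by apply: measurable_signature => p; exact: mS.
(* The default [true] makes [S' c i] the set of all atoms when [c] is out of range, so that the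
   covering and mass hypotheses, which concern every [c], hold there as well. *)
pose mem' c i (a : {set 'I_K * 'I_M}) :=
  if insub c is Some c' then if insub i is Some i' then (c', i') \in a else true
  else true.
pose S' c i := [set a | mem' c i a]%SET.
have mem'E c i x : (c < K)%N -> (i < L c)%N -> mem' c i (sig x) = `[< S c i x >].
  move=> cK iL; rewrite /mem' (insubT (fun c => c < K)%N cK).
  by rewrite (insubT (fun i => i < M)%N (LM _ _ cK iL)) inE.
pose u a := fine (mu (sig @^-1` [set a])).
have uE a : (u a)%:E = mu (sig @^-1` [set a]).
  rewrite fineK // ge0_fin_numE //; apply: (@le_lt_trans _ _ (mu setT)).
    by apply: le_measure; rewrite ?inE.
  by rewrite muT ltry.
have u0 a : 0 <= u a by rewrite -lee_fin uE.
have usum (P : pred _) : (\sum_(a | P a) u a)%:E = mu [set x | P (sig x)].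
  by rewrite measure_fibres // -sumEFin; apply: eq_bigr => a _; rewrite uE.
have uT : \sum_a u a = T.
  by apply: EFin_inj; rewrite usum -muT; congr (mu _); apply/seteqP; split.
have uS c i : (c < K)%N -> (i < L c)%N ->
    (\sum_(a in S' c i) u a)%:E = mu (S c i).
  move=> cK iL; rewrite usum; congr (mu _).
  by apply/seteqP; split => x /=; rewrite inE mem'E //; [move/asboolP|move=> h; apply/asboolP].
have [||||||||||||f [f0 fa fl fsupp]] := @multiscale_allocation R _ u n K lam k L S' eta beta.
- exact: u0.
- by rewrite uT.
- exact: lam0.
- by rewrite uT.
- exact: kK.
- exact: L0.
- move=> c a ua; have [cK|cK] := ltnP c K; last first.
    by exists 0%N => //; rewrite inE /mem' insubN // -leqNgt.
  have [x sx] : exists x, sig x = a.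
    apply: contrapT => nx; case/eqP: ua; apply: EFin_inj; rewrite uE.
    suff -> : sig @^-1` [set a] = set0 by rewrite measure0.
    by apply/seteqP; split => // x /= sx; apply: nx; exists x.
  have [i iL Sx] := cov c x; exists i => //.
  by rewrite inE -sx mem'E //; apply/asboolP.
- exact: eta0.
- exact: etaS.
- exact: beta0.
- move=> c i iL; have [cK|cK] := ltnP c K.
    by rewrite -lee_fin uS // betaS.
  rewrite (eq_bigl xpredT); last by move=> a; rewrite !inE /mem' insubN // -leqNgt.
  rewrite uT -lee_fin -muT; apply: le_trans (betaS c i iL) _.
  by apply: le_measure; rewrite ?inE.
- by rewrite uT.
rewrite -!uT in lamT.
have [|||Y [mY muY dY Ysupp]] := @realize_fractions _ _ R mu fine_covers _ sig n f.
- exact: msig.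
- exact: f0.
- by move=> a; rewrite fa uE.
have muTs : mu setT = (\sum_(j < n) lam j)%:E by rewrite lamT uT.
have muY' (j : 'I_n) : mu (Y j) = (lam j)%:E by rewrite muY // fl.
have dY' (i j : 'I_n) x : Y i x -> Y j x -> i = j.
  by move=> Yi Yj; apply: ord_inj; exact: dY Yi Yj.
have ballj (j : 'I_n) : exists x, Y j `<=` dball rho x (rad (k j)).
  have [i [iL fi]] := fsupp j (ltn_ord j); exists (ctr (k j) i) => x Yx.
  case: (fi _ (Ysupp _ _ Yx)); rewrite inE.
    by rewrite mem'E // => /asboolP; exact: ctr0.
  by case=> i1L; rewrite mem'E // => /asboolP; exact: ctr1.
have [x0 x0P] := choice ballj.
pose B j := dball rho (x0 j) (2 * rad (k j)) : set (borel X).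
have [r r0 rP] : exists2 r : R, 0 < r & forall c, (c < K)%N -> r <= rad c.
  clear - rad0; elim: K => [|K' [r r0 rP]]; first by exists 1.
  exists (Num.min r (rad K')); first by rewrite lt_min r0 rad0.
  move=> c; rewrite ltnS leq_eqVlt ge_min => /orP[/eqP ->|/rP ->//].
  by rewrite lexx orbT.
have mB j : measurable (B j) by exact: measurable_dball.
have YB (j : 'I_n) : Y j `<=` B j.
  apply: subset_trans (x0P j) _; apply: dball_subset.
  by rewrite ler_peMl ?ler1n // ltW.
(* A ball of radius [r] about [x] has positive measure, so it is not contained in the null set
   missed by the pieces. Since [r <= rad (k j)], reaching [x] from the piece that it meets at most
   doubles the radius. *)
have BT x : exists j, B j x.
  apply: contrapT => nB.
  have := ball_gt0 x r0; rewrite ltNge => /negP; apply.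
  rewrite -(full_partition_null (fun j : 'I_n => mY j) muY' dY' muTs).
  apply: le_measure; rewrite ?inE; first exact: measurable_dball.
    by apply/measurableC/fin_bigcup_measurable => //; exact: finite_finset.
  move=> y xy [j _ Yy]; apply: nB; exists j.
  have := dball_triangle bs (x0P j _ Yy) (dball_sym bs xy).
  apply: dball_subset; rewrite mulr_natl mulr2n lerD2l; exact: rP.
have [Z [mZ ZT tZ muZ ZB]] :=
  absorb_null_part (fun j : 'I_n => mY j) mB muY' dY' muTs YB BT.
by exists Z; split => // j; exists (x0 j); exact: ZB.
Qed.

End decomposition_of_walks.

Lemma geometric_half_le (R : realFieldType) (K : nat) :
  \sum_(c < K) (2^-1 : R) ^+ c.+2 <= 2^-1.
Proof.
suff -> : \sum_(c < K) (2^-1 : R) ^+ c.+2 = 2^-1 - 2^-1 ^+ K.+1.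
  by rewrite lerBlDr lerDl exprn_ge0.
elim: K => [|K IH]; first by rewrite big_ord0 expr1 subrr.
by rewrite big_ord_recr /= IH !exprS; field.
Qed.

Lemma exp_small (R : archiRealFieldType) (q e : R) : 0 <= q -> q <= 2^-1 -> 0 < e ->
  exists n : nat, q ^+ n < e.
Proof.
move=> q0 q1 e0; pose n := (Num.truncn e^-1).+1; exists n.
apply: (@le_lt_trans _ _ (n%:R^-1)).
  apply: (@le_trans _ _ (2^-1 ^+ n)); first by rewrite lerXn2r ?nnegrE.
  rewrite exprVn lef_pV2 ?posrE ?exprn_gt0 ?ltr0n // -natrX ler_nat.
  exact/ltnW/ltn_expl.
by rewrite invf_plt ?posrE ?ltr0n // truncnS_gt.
Qed.

(** The size class of an item. The lower bound on [lam] later pays for the radius, the upper one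
    makes the item small against its bins; class 0 takes all large items and has only the lower
    bound. *)
Lemma scale_exists (R : archiRealFieldType) (kappa theta lam : R) :
  0 < kappa -> 0 < theta -> theta <= 2^-1 -> 0 < lam ->
  exists k : nat, kappa * theta ^+ k.+1 < lam /\
    (k = 0%N \/ lam <= kappa * theta ^+ k).
Proof.
move=> k0 th0 th1 l0.
have ex : exists k, kappa * theta ^+ k.+1 < lam.
  have [k kP] := exp_small (ltW th0) th1 (divr_gt0 l0 k0).
  exists k; rewrite mulrC -ltr_pdivlMr //; apply: le_lt_trans kP.
  rewrite exprS ger_pMl ?exprn_gt0 //; apply: le_trans th1 _.
  by rewrite invf_le1 ?ler1n.
exists (ex_minn ex); case: ex_minnP => k kP kmin; split => //.
case: k kP kmin => [|k] kP kmin; [by left|right].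
by rewrite leNgt; apply/negP => /kmin; rewrite ltnn.
Qed.

(** * Choice of scales and constants for a regular measure *)

Section regular.
Context (R : realType) (X : ptopologicalType) (rho : X -> X -> \bar R).
Hypotheses (bs : ball_system rho) (conX : connected [set: X]).
Variables (mu : {measure set (borel X) -> \bar R}) (T s A Delta : R).
Hypotheses (muT : mu setT = T%:E) (s0 : 0 < s) (A1 : 1 <= A) (Delta0 : 0 < Delta).
Hypothesis lower : forall x r, 0 < r -> r <= Delta ->
  ((A^-1 * r `^ s)%:E <= mu (dball rho x r))%E.
Hypothesis upper : forall x r, 0 < r -> r <= Delta ->
  (mu (dball rho x r) <= (A * r `^ s)%:E)%E.

Let A0 : 0 < A. Proof. exact: lt_le_trans A1. Qed.

Lemma regular_lower_half (x : X) (r : R) : 0 < r -> r <= Delta ->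
  ((A^-1 * (r / 2) `^ s)%:E <= mu (dball rho x (r / 2)))%E.
Proof.
move=> r0 rD; apply: lower; first by rewrite divr_gt0.
by apply: le_trans rD; rewrite ler_pdivrMr // ler_peMr ?(ltW r0) // ler1n.
Qed.

(** As [s > 0], the upper regularity bound makes balls of small radius light, and the points of a
    walk provide finitely many of them that cover [X]. *)
Lemma regular_finely_coverable : finely_coverable mu.
Proof.
move=> e e0; pose r := Num.min Delta ((e / A) `^ s^-1).
have r0 : 0 < r by rewrite lt_min Delta0 powR_gt0 // divr_gt0.
have rD : r <= Delta by rewrite /r ge_min lexx.
have re : A * r `^ s <= e.
  rewrite mulrC -ler_pdivlMr //.
  apply: (@le_trans _ _ (((e / A) `^ s^-1) `^ s)).
    apply: ge0_ler_powR; rewrite ?nnegrE ?powR_ge0 ?(ltW s0) ?(ltW r0) //.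
    by rewrite /r ge_min lexx orbT.
  by rewrite -powRrM mulVf ?gt_eqF // powRr1 // divr_ge0 // ltW.
have b0 : 0 < A^-1 * (r / 2) `^ s.
  by rewrite mulr_gt0 ?invr_gt0 // powR_gt0 // divr_gt0.
have [L [w [_ _ _ cov]]] :=
  walk_exists bs conX muT r0 b0 (fun x => regular_lower_half x r0 rD).
exists L, (fun i => dball rho (w i) r); split.
- by move=> i; exact: measurable_dball.
- exact: cov.
- by move=> i _; apply: le_trans (upper _ r0 rD) _; rewrite lee_fin.
Qed.

Lemma regular_ball_gt0 (x : X) (r : R) : 0 < r -> (0 < mu (dball rho x r))%E.
Proof.
move=> r0; pose r' := Num.min r Delta.
have r'0 : 0 < r' by rewrite lt_min r0.
apply: (@lt_le_trans _ _ (A^-1 * r' `^ s)%:E).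
  by rewrite lte_fin mulr_gt0 ?invr_gt0 // powR_gt0.
apply: le_trans (lower x r'0 _) _; first by rewrite /r' ge_min lexx orbT.
apply: le_measure; rewrite ?inE; [exact: measurable_dball..|].
by apply: dball_subset; rewrite /r' ge_min lexx.
Qed.

Lemma regular_total_gt0 : 0 < T.
Proof.
rewrite -lte_fin -muT; apply: lt_le_trans (regular_ball_gt0 point ltr01) _.
by apply: le_measure; rewrite ?inE //; exact: measurable_dball.
Qed.

Lemma regular_decomposition : exists d C : R, 0 < d /\ 0 < C /\
  forall (n : nat) (lam : 'I_n -> R),
    (forall j, 0 < lam j) -> (\sum_(j < n) lam j)%:E = mu [set: X] ->
    exists Y : 'I_n -> set (borel X),
      [/\ forall j, measurable (Y j), \bigcup_(j in [set: 'I_n]) Y j = [set: X],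
          trivIset [set: 'I_n] Y, forall j, mu (Y j) = (lam j)%:E &
          forall j, exists x : X, Y j `<=` dball rho x (C * (lam j `^ d^-1))].
Proof.
have T0 := regular_total_gt0.
pose delta (c : nat) := Delta * 2^-1 ^+ c.
have d0 c : 0 < delta c by rewrite mulr_gt0 // exprn_gt0.
have dD c : delta c <= Delta.
  by rewrite ger_pMr // exprn_ile1 // invf_le1 ?ler1n.
pose beta c := A^-1 * (delta c / 2) `^ s.
have b0 c : 0 < beta c.
  by rewrite mulr_gt0 ?invr_gt0 // powR_gt0 // divr_gt0.
have bball c x : ((beta c)%:E <= mu (dball rho x (delta c)))%E.
  apply: le_trans (regular_lower_half x (d0 c) (dD c)) _.
  apply: le_measure; rewrite ?inE; [exact: measurable_dball..|].
  by apply: dball_subset; rewrite ler_pdivrMr // ler_peMr ?(ltW (d0 c)) // ler1n.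
have bT c : beta c <= T.
  rewrite -lee_fin -muT; apply: le_trans (bball c point) _.
  by apply: le_measure; rewrite ?inE //; exact: measurable_dball.
have ex c := walk_exists bs conX muT (d0 c) (b0 c)
  (fun x => regular_lower_half x (d0 c) (dD c)).
have [L exL] := choice ex; have [w {ex exL}wP] := choice exL.
pose R0 := 4 * delta 0%N * (L 0%N).+1%:R.
have R00 : 0 < R0 by rewrite !mulr_gt0.
have diamR x y : dball rho x R0 y.
  by have [_ _ st cov] := wP 0%N; exact: walk_diameter (d0 0%N) st cov x y.
(* Items of class 0 may be arbitrarily large, so they cannot be compared with bins. Their single bin
   is the whole space, which lies in a ball of radius [R0]. *)
pose L' c := if c is 0%N then 1%N else L c.
pose S c i : set (borel X) := if c is 0%N then setT else dball rho (w c i) (delta c).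
pose ctr c i := if c is 0%N then point else w c i.
(* A step has length less than [2 * delta c], so the ball about the next point lies within
   [3 * delta c] of the present one. *)
pose rad c := if c is 0%N then R0 else 3 * delta c.
pose eta c : R := 2^-1 ^+ c.+2.
pose d := 4 * s + 1.
have dpos : 0 < d by rewrite addr_gt0 // mulr_gt0.
pose theta := (2^-1 : R) `^ d.
have th0 : 0 < theta by rewrite powR_gt0.
have half01 : 0 < (2^-1 : R) <= 1 by rewrite invr_gt0 ltr0n invf_le1 ?ler1n.
have th1 : theta <= 2^-1.
  by rewrite ge1r_powR // lerDr mulr_ge0 // ltW.
pose b := beta 0%N; pose kappa := b ^+ 4 / (16 * T ^+ 3).
have bb0 : 0 < b by exact: b0.
have kap0 : 0 < kappa.
  by apply: divr_gt0; [|apply: mulr_gt0 => //]; apply: exprn_gt0.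
have betaE c : beta c = b * (2^-1 `^ s) ^+ c.
  rewrite /b /beta /delta expr0 mulr1 -[RHS]mulrA; congr (_ * _).
  rewrite -powR_mulrn ?powR_ge0 // powRAC powR_mulrn ?ltW //.
  by rewrite -powRM ?exprn_ge0 // ?divr_ge0 ?(ltW Delta0) // mulrAC.
have thE : theta = 2^-1 * (2^-1 `^ s) ^+ 4.
  rewrite /theta /d powRD; last by rewrite gt_eqF.
  by rewrite powRr1 // mulrC mulrC powRrM powRAC powR_mulrn ?powR_ge0 // mulrC.
(* Since [L c <= 2 * (T / beta c) ^+ 2], the threshold is at least
   [eta c * beta c ^+ 4 / (4 * T ^+ 3)]. With [eta c = 2^(-c-2)] and [beta c = b * 2^(-sc)] this
   equals [kappa * theta ^+ c], which explains the 16 in [kappa] and the value of [d]. *)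
have cap c : kappa * theta ^+ c <= eta c * beta c ^+ 2 / (2 * T * (L c)%:R).
  have [L0 LB _ _] := wP c.
  have TB1 : 1 <= (T / beta c) ^+ 2 by rewrite exprn_ege1 // ler_pdivlMr // mul1r.
  have -> : kappa * theta ^+ c = eta c * beta c ^+ 2 / (2 * T * (2 * (T / beta c) ^+ 2)).
    rewrite thE exprMn exprAC /kappa /eta !exprSr betaE.
    have sg0 : (2^-1 `^ s) ^+ c != 0 :> R by rewrite gt_eqF // exprn_gt0 // powR_gt0.
    by field; rewrite sg0 !gt_eqF //; exact: b0.
  have e0 : 0 < eta c by apply: exprn_gt0.
  have bc0 := b0 c.
  apply: ler_wpM2l; first by rewrite mulr_ge0 ?exprn_ge0 // ltW.
  have LR0 : 0 < (L c)%:R :> R by rewrite ltr0n.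
  rewrite lef_pV2 ?posrE ?mulr_gt0 ?exprn_gt0 ?invr_gt0 //.
  by rewrite ler_pM2l ?mulr_gt0 //; apply: le_trans LB _; rewrite mulrDl mul1r lerD2r.
(* One factor 2 comes from the doubled radius, the other from the exponent [c.+1] in the lower bound
   on the items of class [c]. The equation keeps [C] opaque. *)
have [C Cdef] : exists C, C = 4 * (3 * Delta + R0) / kappa `^ d^-1 by eexists.
have C0 : 0 < C.
  by rewrite Cdef divr_gt0 ?powR_gt0 // mulr_gt0 // addr_gt0 // mulr_gt0.
exists d, C; split => //; split => // n lam lam0 lamT.
pose lam' j := if insub j is Some i then lam i else 1 : R.
have lam'0 j : 0 < lam' j by rewrite /lam'; case: insubP.
have lam'E (j : 'I_n) : lam' j = lam j.
  by rewrite /lam'; case: insubP => [i _ /ord_inj -> //|]; rewrite ltn_ord.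
have exk l : exists k : nat, 0 < l -> kappa * theta ^+ k.+1 < l /\
    (k = 0%N \/ l <= kappa * theta ^+ k).
  have [l0|l0] := boolP (0 < l); last by exists 0%N.
  by have [k kP] := scale_exists kap0 th0 th1 l0; exists k.
have [kf kfP] := choice exk.
(* The summand [kf 1] covers the indices from [n] on, where [lam'] has the default value 1. *)
pose K := (\sum_(j < n) kf (lam' j) + kf 1).+1.
have kK j : (kf (lam' j) < K)%N.
  rewrite /K ltnS; have [jn|jn] := ltnP j n.
    by rewrite (bigD1 (Ordinal jn)) //= -addnA leq_addr.
  by rewrite /lam' insubN -?leqNgt // leq_addl.
have lam'T : \sum_(j < n) lam' j = T.
  by apply: EFin_inj; rewrite -muT -lamT; congr EFin; apply: eq_bigr => j _.
have [||||||||||||||Y [mY YT tY muY YB]] := @decomposition_of_walks R X rho bs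
  mu T muT T0 regular_finely_coverable regular_ball_gt0 n K lam'
  (fun j => kf (lam' j)) L' S eta beta ctr rad.
- by move=> j; exact: ltW.
- exact: lam'T.
- exact: kK.
- by case=> [|c] //=; have [] := wP c.+1.
- by case=> [|c] i //=; exact: measurable_dball.
- by case=> [|c] x /=; [exists 0%N|have [_ _ _ ] := wP c.+1; apply].
- by move=> c; rewrite exprn_gt0.
- exact: geometric_half_le.
- exact: b0.
- case=> [|c] i _ /=; last exact: bball.
  by rewrite muT lee_fin; exact: bT.
- move=> j; have [_ ] := kfP _ (lam'0 j).
  case: (kf (lam' j)) => [|c] /=; first by left.
  by case=> // h; right; apply: le_trans h (cap c.+1).
- by case=> [|c] /=; [exact: R00|rewrite mulr_gt0 // d0].
- case=> [|c] i iL /=; first by move=> x _; exact: diamR.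
  by apply: dball_subset; rewrite ler_peMl ?ler1n // ltW.
- case=> [|c] i //= iL x.
  have [_ _ st _] := wP c.+1.
  move=> /(dball_triangle bs (st i iL)); apply: dball_subset.
  by have -> : 3 * delta c.+1 = 2 * delta c.+1 + delta c.+1 by ring.
exists Y; split => // [j|j]; first by rewrite muY lam'E.
have [x Yx] := YB j; exists x; apply: subset_trans Yx _; apply: dball_subset.
have [kl _] := kfP _ (lam'0 j); rewrite lam'E in kl *.
set c := kf (lam j) in kl *.
have radle : rad c <= (3 * Delta + R0) * 2^-1 ^+ c.
  case: c {kl} => [|c]; first by rewrite expr0 mulr1 lerDr mulr_ge0 // ltW.
  rewrite /rad /delta mulrA; apply: ler_wpM2r; first exact: exprn_ge0.
  by rewrite lerDl ltW.
have lamge : kappa `^ d^-1 * 2^-1 ^+ c.+1 <= lam j `^ d^-1.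
  apply: (@le_trans _ _ ((kappa * theta ^+ c.+1) `^ d^-1)); last first.
    apply: ge0_ler_powR; rewrite ?nnegrE ?invr_ge0 ?(ltW dpos) ?(ltW (lam0 j)) ?(ltW kl) //.
    by rewrite mulr_ge0 ?exprn_ge0 // ltW.
  rewrite (powRM _ (ltW kap0) (exprn_ge0 _ (ltW th0))).
  suff -> : (theta ^+ c.+1) `^ d^-1 = 2^-1 ^+ c.+1 by [].
  rewrite -powR_mulrn ?(ltW th0) // powRAC /theta -(powRrM _ d) mulfV ?gt_eqF //.
  by rewrite powRr1 // powR_mulrn.
have kd0 : 0 < kappa `^ d^-1 by rewrite powR_gt0.
rewrite Cdef mulrAC ler_pdivlMr //.
apply: (@le_trans _ _ (4 * (3 * Delta + R0) * (kappa `^ d^-1 * 2^-1 ^+ c.+1))).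
  rewrite exprS.
  have -> : 4 * (3 * Delta + R0) * (kappa `^ d^-1 * (2^-1 * 2^-1 ^+ c)) =
    2 * ((3 * Delta + R0) * 2^-1 ^+ c) * kappa `^ d^-1 by field.
  by rewrite ler_pM2r // ler_pM2l.
by rewrite ler_pM2l // mulr_gt0 // addr_gt0 // mulr_gt0.
Qed.

End regular.

Lemma regular_measure_decomposition (R : realType) (X : ptopologicalType)
    (rho : X -> X -> \bar R) (mu : {measure set (borel X) -> \bar R}) :
  ball_system rho -> connected [set: X] -> (exists x y, (0 < rho x y)%E) ->
  ahlfors_david_regular rho mu ->
  exists d C : R, 0 < d /\ 0 < C /\
  forall (n : nat) (lam : 'I_n -> R),
    (forall j, 0 < lam j) -> (\sum_(j < n) lam j)%:E = mu [set: X] ->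
    exists Y : 'I_n -> set (borel X),
      [/\ forall j, measurable (Y j), \bigcup_(j in [set: 'I_n]) Y j = [set: X],
          trivIset [set: 'I_n] Y, forall j, mu (Y j) = (lam j)%:E &
          forall j, exists x : X, Y j `<=` dball rho x (C * (lam j `^ d^-1))].
Proof.
move=> bs conX [x [y xy]] [s [A [A1 reg]]].
(* If the total measure is infinite, no finite family of real numbers sums to it and any constants
   do. *)
have [[T muT]|infT] := pselect (exists T, mu setT = T%:E); last first.
  exists 1, 1; split => //; split => // n lam _ e.
  by case: infT; exists (\sum_(j < n) lam j).
(* [Delta] is a finite positive radius up to which regularity applies, also when the distance from
   [x] to [y] is infinite. *)
have [Delta Delta0 DD] : exists2 Delta : R, 0 < Delta & (Delta%:E <= diam rho)%E.
  have xyd : (rho x y <= diam rho)%E by apply: ereal_sup_ubound; exists (x, y).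
  case E : (rho x y) xy xyd => [r| |] // xy xyd; first by exists r.
  by exists 1 => //; apply: le_trans xyd; rewrite leey.
have lower z r : 0 < r -> r <= Delta -> ((A^-1 * r `^ s)%:E <= mu (dball rho z r))%E.
  by move=> r0 rD; have [] := reg z r r0 (le_trans _ DD).
have upper z r : 0 < r -> r <= Delta -> (mu (dball rho z r) <= (A * r `^ s)%:E)%E.
  by move=> r0 rD; have [] := reg z r r0 (le_trans _ DD).
have A0 : 0 < A^-1 by rewrite invr_gt0 (lt_le_trans ltr01).
have s0 := regular_exponent_gt0 bs conX muT A0 Delta0 lower xy.
exact (@regular_decomposition R X rho bs conX mu T s A Delta
  muT s0 A1 Delta0 lower upper).
Qed.

(** * Derivatives, charts and tangent vectors *)

Section within_derivative.
Context (R : realType).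
Implicit Types U V W : normedModType R.

(** Derivatives are bundled linear maps, so a formula for a derivative has to be packed before it
    can serve as a witness. *)
Lemma scaling_linear_exists V (v : V) :
  exists L : {linear R -> V}, forall r, L r = r *: v.
Proof.
have lin : linear (fun r : R => r *: v).
  by move=> a x y; rewrite scalerDl -[a *: x]/(a * x) scalerA.
pose H := GRing.isLinear.Build R R V *:%R (fun r : R => r *: v) lin.
pose L : {linear R -> V} := HB.pack (fun r : R => r *: v) H.
by exists L.
Qed.

Lemma linear_comp_exists U V W (L : {linear U -> V}) (K : {linear V -> W}) :
  exists M : {linear U -> W}, forall u, M u = K (L u).
Proof.
have lin : linear (fun u => K (L u)) by move=> a x y; rewrite !linearP.
pose H := GRing.isLinear.Build R U W *:%R (fun u => K (L u)) lin.
pose M : {linear U -> W} := HB.pack (fun u => K (L u)) H.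
by exists M.
Qed.

Lemma linear_real_bounded V (L : {linear R -> V}) :
  exists2 C : R, 0 <= C & forall r : R, `|L r| <= C * `|r|.
Proof.
exists `|L 1| => // r.
have -> : L r = r *: L 1 by rewrite -linearZ; congr (L _); rewrite -[LHS]mulr1.
by rewrite normrZ mulrC.
Qed.

Lemma row_coord_le (n : nat) (v : 'rV[R]_n) (i : 'I_n) : `|v 0 i| <= `|v|.
Proof.
rewrite [leRHS]/Num.Def.normr /= mx_normrE.
exact: (le_bigmax _ (fun ij : 'I_1 * 'I_n => `|v ij.1 ij.2|) (0, i)).
Qed.

Lemma linear_row_bounded (n : nat) V (L : {linear 'rV[R]_n -> V}) :
  exists2 C : R, 0 <= C & forall v, `|L v| <= C * `|v|.
Proof.
exists (\sum_i `|L (delta_mx 0 i)|); first exact: sumr_ge0.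
move=> v; rewrite [v in L v]row_sum_delta linear_sum mulr_suml.
apply: le_trans (ler_norm_sum _ _ _) _; apply: ler_sum => i _.
by rewrite linearZ normrZ mulrC ler_wpM2l // row_coord_le.
Qed.

Lemma is_diff_within_subset V W (D E : set V) (f : V -> W) x (L : {linear V -> W}) :
  E `<=` D -> is_diff_within D f x L -> is_diff_within E f x L.
Proof.
move=> ED df e e0; have := df e e0; rewrite !near_withinE.
by apply: filterS => y h /ED.
Qed.

Lemma is_diff_within_eq V W (D : set V) (f g : V -> W) x (L : {linear V -> W}) :
  {in D, f =1 g} -> D x -> is_diff_within D f x L -> is_diff_within D g x L.
Proof.
move=> fg Dx df e e0; have := df e e0; rewrite !near_withinE.
by apply: filterS => y h Dy; rewrite -!fg ?inE //; exact: h.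
Qed.

Lemma is_diff_within_lip V W (D : set V) (f : V -> W) x (L : {linear V -> W}) (C : R) :
  (forall v, `|L v| <= C * `|v|) -> is_diff_within D f x L ->
  \forall y \near nbhs x, D y -> `|f y - f x| <= (C + 1) * `|y - x|.
Proof.
move=> LC /(_ 1 ltr01); rewrite near_withinE; apply: filterS => y h Dy.
have := h Dy; rewrite mul1r => {}h.
rewrite -[f y - f x](subrK (L (y - x))) mulrDl mul1r addrC.
by apply: le_trans (ler_normD _ _) _; apply: lerD.
Qed.

(** The chain rule relative to sets. A linear map between normed modules may be unbounded, hence the
    explicit bounds; [M] is any bundled map with the values of the composite. *)
Lemma is_diff_within_comp U V W (D : set U) (E : set V) (f : U -> V) (g : V -> W)
    x (L : {linear U -> V}) (K : {linear V -> W}) (M : {linear U -> W}) (CL CK : R) :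
  (forall u, `|L u| <= CL * `|u|) -> (forall v, `|K v| <= CK * `|v|) ->
  0 <= CL -> 0 <= CK ->
  (forall u, M u = K (L u)) -> (forall y, D y -> E (f y)) ->
  is_diff_within D f x L -> is_diff_within E g (f x) K ->
  is_diff_within D (g \o f) x M.
Proof.
move=> LC KC CL0 CK0 ME DE df dg e e0.
(* Half of the error is that of [g], enlarged by the local Lipschitz constant [CL + 1] of [f]; the
   other half is that of [f], enlarged by the bound [CK]. *)
pose e1 := e / 2 / (CL + 1); pose e2 := e / 2 / (CK + 1).
have e10 : 0 < e1 by rewrite !divr_gt0 // ltr_wpDl.
have e20 : 0 < e2 by rewrite !divr_gt0 // ltr_wpDl.
have lip := is_diff_within_lip LC df.
have := df e2 e20; have /nbhs_ballP[r /= r0 hg] := dg e1 e10.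
rewrite !near_withinE => hf.
have near0 : \forall y \near nbhs x, (CL + 1) * `|y - x| < r.
  have : \forall y \near nbhs x, `|x - y| < r / (CL + 1).
    apply/nbhs_ballP; exists (r / (CL + 1)); last by move=> y; rewrite -ball_normE.
    by rewrite /= divr_gt0 // ltr_wpDl.
  apply: filterS => y; rewrite distrC ltr_pdivlMr ?ltr_wpDl // mulrC.
  by [].
apply: filterS3 lip hf near0 => y /= lipy hfy n0 Dy.
have {}lipy := lipy Dy; have {}hfy := hfy Dy.
have fr : `|f x - f y| < r by rewrite distrC; apply: le_lt_trans lipy n0.
have bfr : ball (f x) r (f y) by rewrite -ball_normE.
have hgy := hg (f y) bfr (DE _ Dy).
rewrite ME -[L (y - x)](subKr (f y - f x)) linearB opprB addrA.
have -> : g (f y) - g (f x) + K (f y - f x - L (y - x)) - K (f y - f x) =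
  (g (f y) - g (f x) - K (f y - f x)) + K (f y - f x - L (y - x)).
  by rewrite addrAC.
apply: le_trans (ler_normD _ _) _.
rewrite [e]splitr mulrDl; apply: lerD.
  apply: le_trans hgy _; apply: (@le_trans _ _ (e1 * ((CL + 1) * `|y - x|))).
    by rewrite ler_pM2l.
  by rewrite mulrA /e1 divfK // gt_eqF // ltr_wpDl.
apply: le_trans (KC _) _.
apply: (@le_trans _ _ (CK * (e2 * `|y - x|))); first by rewrite ler_wpM2l.
rewrite mulrA ler_wpM2r // /e2 mulrCA ger_pMr ?divr_gt0 //.
by rewrite ler_pdivrMr ?ltr_wpDl // mul1r lerDl.
Qed.

Lemma is_diff_within_derive1 V (D : set R) (f : R -> V) u (L : {linear R -> V}) :
  nbhs u D -> is_diff_within D f u L -> is_derive u 1 f (L 1).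
Proof.
move=> nD df.
have cv : (fun h => h^-1 *: (f (h + u) - f u)) @ 0^' --> L 1.
  apply/cvgrPdist_le => e e0.
  have := df e e0; rewrite near_withinE => hf.
  have : \forall y \near nbhs u, `|f y - f u - L (y - u)| <= e * `|y - u|.
    by apply: filterS2 nD hf => y Dy; apply.
  move=> /nbhs_ballP[r /= r0 hr].
  near=> h.
  have h0 : h != 0 by near: h; exact: nbhs_dnbhs_neq.
  have hr' : `|h| < r by near: h; exact: dnbhs0_lt.
  have /hr : ball u r (h + u) by rewrite /ball /= opprD addrCA subrr addr0 normrN.
  rewrite addrK => H.
  have Lh : L h = h *: L 1 by rewrite -linearZ; congr (L _); rewrite -[LHS]mulr1.
  rewrite -[L 1](scalerK h0) -Lh -scalerBr normrZ normfV distrC.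
  by rewrite ler_pdivrMl ?normr_gt0 // mulrC.
have e : (fun h => h^-1 *: ((f \o shift u) (h *: 1) - f u)) =
    (fun h => h^-1 *: (f (h + u) - f u)).
  by apply/funext => h /=; rewrite [h *: 1]mulr1.
apply: DeriveDef; first by apply/cvg_ex; exists (L 1); rewrite e.
by rewrite /derive e; apply: cvg_lim cv.
Unshelve. all: by end_near. Qed.

(** A single ray into [D] determines the derivative in its direction: at [x + t *: h] both linear
    maps approximate the same increment up to [o(t)]. This also works at boundary points. *)
Lemma is_diff_within_unique V W (D : set V) (f : V -> W) x h (L K : {linear V -> W}) :
  (exists2 r : R, 0 < r & forall t, 0 < t -> t < r -> D (x + t *: h)) ->
  is_diff_within D f x L -> is_diff_within D f x K -> L h = K h.
Proof.
move=> [r r0 Dh] dL dK.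
have [-> | h0] := eqVneq h 0; first by rewrite !linear0.
have nh0 : 0 < `|h| by rewrite normr_gt0.
apply/eqP; rewrite -subr_eq0 -normr_le0; apply/ler_addgt0Pr => e e0.
rewrite add0r.
pose e' := e / 2 / `|h|; have e'0 : 0 < e' by rewrite !divr_gt0.
have := dL e' e'0; have := dK e' e'0; rewrite !near_withinE.
move=> /nbhs_ballP[r1 /= r10 h1] /nbhs_ballP[r2 /= r20 h2].
pose t := Num.min (r / 2) (Num.min (r1 / 2 / `|h|) (r2 / 2 / `|h|)).
have t0 : 0 < t by rewrite !lt_min !divr_gt0.
have tr : t < r.
  apply: (@le_lt_trans _ _ (r / 2)); first by rewrite /t ge_min lexx.
  by rewrite ltr_pdivrMr // ltr_pMr // ltr1n.
have tsm q : 0 < q -> t <= q / 2 / `|h| -> ball x q (x + t *: h).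
  move=> q0 tq; rewrite -ball_normE /= opprD addNKr normrN normrZ gtr0_norm //.
  rewrite -ltr_pdivlMr //; apply: le_lt_trans tq _.
  by rewrite ltr_pM2r ?invr_gt0 // ltr_pdivrMr // ltr_pMr // ltr1n.
have eL : L (t *: h) = t *: L h by rewrite linearZ.
have eK : K (t *: h) = t *: K h by rewrite linearZ.
have Dt := Dh t t0 tr.
have /h1 /(_ Dt) : ball x r1 (x + t *: h).
  by apply: tsm => //; rewrite /t !ge_min lexx orbT.
have /h2 /(_ Dt) : ball x r2 (x + t *: h).
  by apply: tsm => //; rewrite /t !ge_min lexx !orbT.
rewrite [x + t *: h]addrC addrK eL eK normrZ (gtr0_norm t0) => H2 H1.
have : `|t *: L h - t *: K h| <= 2 * (e' * (t * `|h|)).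
  set F := f _ - f _ in H1 H2.
  rewrite (_ : t *: L h - t *: K h = (F - t *: K h) - (F - t *: L h)); last first.
    by rewrite opprB [RHS]addrC addrA subrK.
  by apply: le_trans (ler_normB _ _) _; rewrite mulr_natl mulr2n; apply: lerD.
rewrite -scalerBr normrZ (gtr0_norm t0).
have -> : 2 * (e' * (t * `|h|)) = t * e by rewrite /e'; field; rewrite gt_eqF.
by rewrite ler_pM2l.
Qed.

End within_derivative.

Section chart_geometry.
Context (R : realType) (m : nat) (M : topologicalType).
Variable c : chart R m M.

Lemma model_convex (x y : 'rV[R]_m) (u : R) : chart_model c x -> chart_model c y ->
  0 <= u -> u <= 1 -> chart_model c (x + u *: (y - x)).
Proof.
case: (chart_modelP c) => [->//|[a [b [_ ->]]]] /= bx by_ u0 u1.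
rewrite mulmxDl -scalemxAl mulmxBl !mxE.
set X := (\sum_j _) in bx *; set Y := (\sum_j _) in by_ *.
rewrite !mxE in bx by_.
have : (1 - u) * b + u * b <= (1 - u) * X + u * Y.
  by apply: lerD; rewrite ler_wpM2l // subr_ge0.
by rewrite -mulrDl subrK mul1r => /le_trans; apply; rewrite mulrBl mul1r mulrBr addrAC addrA.
Qed.

Lemma model_direction (x h : 'rV[R]_m) : chart_model c x ->
  (forall t, 0 <= t -> chart_model c (x + t *: h)) \/
  (forall t, 0 <= t -> chart_model c (x + t *: - h)).
Proof.
case: (chart_modelP c) => [-> _|[a [b [_ ->]]]]; first by left.
move=> /= bx; have [ha|ha] := leP 0 ((h *m a) 0 0); [left|right] => t t0.
  by rewrite mulmxDl -scalemxAl mxE [X in _ + X]mxE -[b]addr0 lerD // mulr_ge0.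
rewrite mulmxDl -scalemxAl mulNmx mxE [X in _ + X]mxE [X in _ * X]mxE.
by rewrite -[b]addr0 lerD // mulr_ge0 // oppr_ge0 ltW.
Qed.

Lemma chart_invK (y : 'rV[R]_m) : (c @` chart_dom c) y ->
  chart_dom c (chart_inv c y) /\ c (chart_inv c y) = y.
Proof. by move=> [q dq <-]; rewrite chart_mapK. Qed.

Lemma chart_image_model (p : M) : chart_dom c p -> chart_model c (c p).
Proof.
move=> dp; have [Om _ e] := chart_image_open c.
have : (c @` chart_dom c) (c p) by exists p.
by rewrite e => -[].
Qed.

(** The image of a chart is relatively open in its model and the inverse is continuous on it, so
    every model point close to [c p] is the image of a point close to [p]. *)
Lemma chart_inv_near (p : M) (U : set M) : chart_dom c p -> nbhs p U ->
  exists2 r : R, 0 < r & forall y, chart_model c y -> `|c p - y| < r ->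
    [/\ chart_dom c (chart_inv c y), c (chart_inv c y) = y & U (chart_inv c y)].
Proof.
move=> dp pU; have [Om oO e] := chart_image_open c.
have im : (c @` chart_dom c) (c p) by exists p.
have /nbhs_ballP[r1 /= r10 h1] : nbhs (c p) Om.
  by apply: open_nbhs_nbhs; split => //; move: im; rewrite e => -[].
have := @chart_inv_continuous _ _ _ c; move=> /subspace_continuousP /(_ _ im).
move=> cv; have pU' : nbhs (chart_inv c (c p)) U by rewrite chart_mapK.
have := cv _ pU'; rewrite /= nbhs_simpl /= => /nbhs_ballP[r2 /= r20 h2].
exists (Num.min r1 r2); first by rewrite lt_min r10.
move=> y my; rewrite lt_min => /andP[y1 y2].
have imy : (c @` chart_dom c) y.
  by rewrite e; split => //; apply: h1; rewrite -ball_normE.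
have [d e'] := chart_invK imy; split => //.
by apply: h2 => //; rewrite -ball_normE.
Qed.

Lemma chart_map_near (p : M) (e : R) : chart_dom c p -> 0 < e ->
  \forall q \near p, chart_dom c q /\ `|c p - c q| < e.
Proof.
move=> dp e0; have := @chart_map_continuous _ _ _ c.
rewrite continuous_open_subspace; last exact: chart_dom_open.
move=> /(_ p (mem_set dp)) /cvgrPdist_lt /(_ e e0) h.
apply: filterS2 h (open_nbhs_nbhs (conj (chart_dom_open c) dp)).
by move=> q.
Qed.

(** At a boundary point only inward rays are available, but by [model_direction] one of [h] and
    [- h] points inward, and linearity settles the other. *)
Lemma chart_diff_unique (W : normedModType R) (U : set M) (f : 'rV[R]_m -> W) (p : M)
    (L K : {linear 'rV[R]_m -> W}) :
  nbhs p U -> chart_dom c p ->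
  is_diff_within (c @` (chart_dom c `&` U)) f (c p) L ->
  is_diff_within (c @` (chart_dom c `&` U)) f (c p) K -> L =1 K.
Proof.
move=> pU dp dL dK.
have [r r0 rP] := chart_inv_near dp pU.
suff dir h : (forall t, 0 <= t -> chart_model c (c p + t *: h)) -> L h = K h.
  move=> h; case: (model_direction h (chart_image_model dp)); first exact: dir.
  by move/dir; rewrite !linearN => /oppr_inj.
move=> mh; apply: (is_diff_within_unique _ dL dK).
exists (r / (`|h| + 1)); first by rewrite divr_gt0 // ltr_wpDl.
move=> t t0; rewrite ltr_pdivlMr ?ltr_wpDl // => tr.
have [||d e Ui] := rP (c p + t *: h); first exact/mh/ltW.
  rewrite opprD addNKr normrN normrZ gtr0_norm //; apply: le_lt_trans tr.
  by rewrite ler_pM2l // lerDl.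
by exists (chart_inv c (c p + t *: h)).
Qed.

End chart_geometry.

Section tangent_vectors.
Context (R : realType) (m : nat) (M : C1_manifold R m).
Implicit Types (p : M) (i j k : atlas_index M).

Lemma transition_diff i j p : chart_dom (atlas i) p -> chart_dom (atlas j) p ->
  exists L : {linear 'rV[R]_m -> 'rV[R]_m},
    is_diff_within (transition_dom (atlas i) (atlas j))
      (transition (atlas i) (atlas j)) (atlas i p) L.
Proof.
move=> ip jp; have [df dfP _] := atlas_C1 i j.
by exists (df (atlas i p)); apply: dfP; exists p.
Qed.

Lemma transitionE i j p : chart_dom (atlas i) p ->
  transition (atlas i) (atlas j) (atlas i p) = atlas j p.
Proof. by move=> ip; rewrite /transition chart_mapK. Qed.

Lemma nbhs_chart_dom i p : chart_dom (atlas i) p -> nbhs p (chart_dom (atlas i)).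
Proof. by move=> ip; apply: open_nbhs_nbhs; split => //; exact: chart_dom_open. Qed.

(** The cocycle rule: on the triple overlap the chain rule yields a second derivative of the
    transition from [i] to [k], and such derivatives are unique. *)
Lemma transition_diff_comp i j k p (L K N : {linear 'rV[R]_m -> 'rV[R]_m}) :
  chart_dom (atlas i) p -> chart_dom (atlas j) p -> chart_dom (atlas k) p ->
  is_diff_within (transition_dom (atlas i) (atlas j))
    (transition (atlas i) (atlas j)) (atlas i p) L ->
  is_diff_within (transition_dom (atlas j) (atlas k))
    (transition (atlas j) (atlas k)) (atlas j p) K ->
  is_diff_within (transition_dom (atlas i) (atlas k))
    (transition (atlas i) (atlas k)) (atlas i p) N ->
  forall w, N w = K (L w).
Proof.
move=> ip jp kp dL dK dN w.
have [KL KLE] := linear_comp_exists L K; rewrite -KLE; move: w.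
have [CL CL0 LC] := linear_row_bounded L; have [CK CK0 KC] := linear_row_bounded K.
pose D := atlas i @` (chart_dom (atlas i) `&` (chart_dom (atlas j) `&` chart_dom (atlas k))).
have Dp : D (atlas i p) by exists p.
have Dj : D `<=` transition_dom (atlas i) (atlas j).
  by move=> _ [q [iq [jq kq]] <-]; exists q.
have Dk : D `<=` transition_dom (atlas i) (atlas k).
  by move=> _ [q [iq [jq kq]] <-]; exists q.
apply: (@chart_diff_unique _ _ _ (atlas i) _ _ (transition (atlas i) (atlas k)) p).
- exact: filterI (nbhs_chart_dom jp) (nbhs_chart_dom kp).
- by [].
- exact: is_diff_within_subset dN.
have := @is_diff_within_comp R _ _ _ D _ _ _ _ L K KL CL CK LC KC CL0 CK0 KLE _
  (is_diff_within_subset Dj dL); rewrite transitionE // => /(_ _ _ _ dK) h.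
apply: (is_diff_within_eq _ Dp (h _)).
  move=> x; rewrite inE => -[q [iq [jq kq]] <-] /=.
  by rewrite !transitionE.
by move=> _ [q [iq [jq kq]] <-]; rewrite transitionE //; exists q.
Qed.

(** Carry [w] into every other chart by the derivative of the transition from [i]; the cocycle rule
    is the compatibility required of a tangent vector. Thus positivity on tangent vectors passes to
    Gram matrices. *)
Lemma tangent_exists i p (w : 'rV[R]_m) : chart_dom (atlas i) p ->
  exists2 v, tangent p v & v i = w.
Proof.
move=> ip.
have ex j : exists L : {linear 'rV[R]_m -> 'rV[R]_m}, chart_dom (atlas j) p ->
    is_diff_within (transition_dom (atlas i) (atlas j))
      (transition (atlas i) (atlas j)) (atlas i p) L.
  have [jp|jp] := pselect (chart_dom (atlas j) p); last by exists idfun.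
  by have [L LP] := transition_diff ip jp; exists L.
have [L LP] := choice ex.
exists (fun j => if `[< chart_dom (atlas j) p >] then L j w else 0).
  split=> [j jp|j k jp kp]; first by rewrite asboolF.
  have [K KP] := transition_diff jp kp; exists K => //.
  by rewrite !asboolT //; exact: transition_diff_comp (LP j jp) KP (LP k kp) w.
rewrite asboolT //.
have di : is_diff_within (transition_dom (atlas i) (atlas i))
    (transition (atlas i) (atlas i)) (atlas i p) idfun.
  apply: (@is_diff_within_eq _ _ _ _ id).
  - by move=> x; rewrite inE => -[q [iq _] <-]; rewrite transitionE.
  - by exists p.
  move=> e e0; apply: nearW => y.
  by rewrite subrr normr0 mulr_ge0 // ltW.
by rewrite (chart_diff_unique (nbhs_chart_dom ip) ip (LP i ip) di).
Qed.

Lemma tangent0 p : tangent p (fun=> 0).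
Proof.
split=> // i j ip jp; have [L LP] := transition_diff ip jp.
by exists L => //; rewrite linear0.
Qed.

Lemma tangentZ p (a : R) v : tangent p v -> tangent p (a *: v).
Proof.
move=> [v0 vL]; split=> [i ip|i j ip jp].
  by rewrite [LHS](_ : _ = a *: v i) // v0 // scaler0.
have [L LP e] := vL i j ip jp; exists L => //.
by rewrite [LHS](_ : _ = a *: v j) // [X in L X](_ : _ = a *: v i) // e linearZ.
Qed.

End tangent_vectors.

(** * Quadratic forms and local bounds for the metric *)

Section quadratic_forms.
Context (R : realType) (m : nat).
Implicit Types (A B : 'M[R]_m) (w : 'rV[R]_m).

Definition quad_form A w : R := (w *m A *m w^T) 0 0.

Lemma mx_coord_le A i j : `|A i j| <= `|A|.
Proof.
rewrite [leRHS]/Num.Def.normr /= mx_normrE.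
exact: (le_bigmax _ (fun ij : 'I_m * 'I_m => `|A ij.1 ij.2|) (i, j)).
Qed.

Lemma quad_formE A w : quad_form A w = \sum_j \sum_i w 0 i * A i j * w 0 j.
Proof.
rewrite /quad_form mxE; apply: eq_bigr => j _.
by rewrite !mxE mulr_suml.
Qed.

Lemma quad_formB A B w : quad_form (A - B) w = quad_form A w - quad_form B w.
Proof. by rewrite /quad_form mulmxBr mulmxBl !mxE. Qed.

Lemma quad_formZ A (a : R) w : quad_form A (a *: w) = a ^+ 2 * quad_form A w.
Proof.
rewrite /quad_form linearZ /= -scalemxAr -!scalemxAl scalerA.
by rewrite mxE expr2.
Qed.

Lemma quad_form_bound A w : `|quad_form A w| <= (m * m)%:R * `|A| * `|w| ^+ 2.
Proof.
rewrite quad_formE; apply: le_trans (ler_norm_sum _ _ _) _.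
apply: (@le_trans _ _ (\sum_(j < m) \sum_(i < m) `|A| * `|w| ^+ 2)).
  apply: ler_sum => j _; apply: le_trans (ler_norm_sum _ _ _) _.
  apply: ler_sum => i _; rewrite !normrM mulrAC mulrC expr2.
  by rewrite ler_pM ?mulr_ge0 // ?mx_coord_le // ler_pM // row_coord_le.
by rewrite !sumr_const !card_ord -mulrnA -mulrA mulr_natl.
Qed.

Lemma cvg_quad_form (T : Type) (F : set_system T) (FF : Filter F)
    (A : T -> 'M[R]_m) (w : T -> 'rV[R]_m) A0 w0 :
  A @ F --> A0 -> w @ F --> w0 ->
  (fun t => quad_form (A t) (w t)) @ F --> quad_form A0 w0.
Proof.
move=> cA cw.
have ww k : (fun t => w t 0 k) @ F --> w0 0 k.
  exact: (cvg_comp w (fun v : 'rV[R]_m => v 0 k) cw (@coord_continuous _ _ _ 0 k w0)).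
have AA i j : (fun t => A t i j) @ F --> A0 i j.
  exact: (cvg_comp A (fun v : 'M[R]_m => v i j) cA (@coord_continuous _ _ _ i j A0)).
rewrite quad_formE (_ : (fun t => _) =
  (fun t => \sum_j \sum_i w t 0 i * A t i j * w t 0 j)); last first.
  by apply/funext => t; rewrite quad_formE.
apply: cvg_big; first exact: add_continuous.
move=> j _; apply: cvg_big; first exact: add_continuous.
by move=> i _; apply: cvgM; [apply: cvgM|].
Qed.

(** The minimum on the compact unit sphere is positive, and homogeneity extends the bound to all
    vectors. *)
Lemma positive_quad_form A : (forall w, w != 0 -> 0 < quad_form A w) ->
  exists2 c : R, 0 < c & forall w, c * `|w| ^+ 2 <= quad_form A w.
Proof.
move=> pos; pose S := [set w : 'rV[R]_m | `|w| = 1].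
suff [c c0 cS] : exists2 c : R, 0 < c & forall w, S w -> c <= quad_form A w.
  exists c => // w; have [->|w0] := eqVneq w 0.
    have := quad_formZ A 0 0; rewrite scale0r expr0n mul0r => ->.
    by rewrite normr0 expr0n mulr0.
  have nw : `|w| != 0 by rewrite normr_eq0.
  have := cS (`|w|^-1 *: w) _; rewrite quad_formZ exprVn mulrC -ler_pdivlMr ?exprn_gt0 ?normr_gt0 //.
  rewrite ler_pdivlMr ?exprn_gt0 ?normr_gt0 //; apply.
  by rewrite /S /= normrZ normfV normr_id mulVf.
(* The sphere is empty in dimension 0. *)
have [[w0 Sw0]|noS] := pselect (exists w, S w); last first.
  by exists 1 => // w Sw; case: noS; exists w.
have cS : compact S.
  apply: bounded_closed_compact.
    exists 1; split => // x x1 w /= ->; exact: ltW.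
  have -> : S = Num.norm @^-1` [set 1] by [].
  apply: preimage_closed; last exact: closed_eq.
  by move=> w _; exact: norm_continuous.
have cq : {within S, continuous (quad_form A)}.
  apply: continuous_subspaceT => w.
  by apply: (@cvg_quad_form _ (nbhs w) _ (cst A) id); [exact: cvg_cst|exact: cvg_id].
have [w wS wmin] := EVT_min_rV (ex_intro _ w0 Sw0) cS cq.
exists (quad_form A w).
  apply: pos; apply/eqP => e; move: wS; rewrite inE /S /= e normr0 => /eqP.
  by rewrite eq_sym oner_eq0.
by move=> v Sv; apply: wmin; rewrite inE.
Qed.

End quadratic_forms.

Section metric.
Context (R : realType) (m : nat) (M : C1_manifold R m) (g : riemannian_metric M).

Lemma innerZZ (p : M) (a : R) v : tangent p v -> g p (a *: v) (a *: v) = a ^+ 2 * g p v v.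
Proof.
move=> tv; have t0 : tangent p 0 := tangent0 p.
have i0 w : tangent p w -> g p 0 w = 0.
  move=> tw; have := inner_linear g 1 t0 t0 tw.
  by rewrite scaler0 addr0 mul1r -[LHS]addr0 => /addrI <-.
have iZ w : tangent p w -> g p (a *: v) w = a * g p v w.
  by move=> tw; rewrite -[a *: v]addr0 inner_linear // i0 // addr0.
have tav := tangentZ a tv.
by rewrite iZ // inner_sym // iZ // mulrA expr2.
Qed.

(** Positivity at [p] and continuity of the Gram matrix compare the metric near [p] with the norm in
    the chart. The upper bound makes short segments short for [g]; the lower one bounds lengths by
    displacements. *)
Lemma gram_bounds (i : atlas_index M) (p : M) : chart_dom (atlas i) p ->
  exists c C : R, [/\ 0 < c, 0 < C & \forall q \near p,
    chart_dom (atlas i) q /\ forall v, tangent q v ->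
      c * `|v i| ^+ 2 <= g q v v <= C * `|v i| ^+ 2].
Proof.
move=> ip; have [G cG GE] := inner_continuous g i.
have [c c0 cP] : exists2 c : R, 0 < c & forall w, c * `|w| ^+ 2 <= quad_form (G p) w.
  apply: positive_quad_form => w w0; have [v tv vi] := tangent_exists w ip.
  rewrite -vi /quad_form -GE //; apply: inner_pos => // v0.
  by move: w0; rewrite -vi v0 eqxx.
(* An entrywise change of the Gram matrix by [c / 2 / N] changes its quadratic form by at most
   [c / 2] times the squared norm. *)
pose N : R := (m * m)%:R + 1.
have N0 : 0 < N by rewrite ltr_wpDl.
have e0 : 0 < c / 2 / N by rewrite !divr_gt0.
exists (c / 2), (N * `|G p| + c / 2 + 1); split.
- by rewrite divr_gt0.
- by rewrite ltr_wpDl // addr_ge0 // ?divr_ge0 ?mulr_ge0 // ltW.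
move: cG; rewrite continuous_open_subspace; last exact: chart_dom_open.
move=> /(_ p (mem_set ip)) /cvgrPdist_le /(_ _ e0) near1.
apply: filterS2 near1 (nbhs_chart_dom ip) => q Gq iq; split => // v tv.
rewrite (GE q v v) // -/(quad_form _ _).
have d : `|quad_form (G p) (v i) - quad_form (G q) (v i)| <= c / 2 * `|v i| ^+ 2.
  rewrite -quad_formB; apply: le_trans (quad_form_bound _ _) _.
  rewrite ler_wpM2r ?exprn_ge0 //.
  apply: (@le_trans _ _ (N * (c / 2 / N))); last by rewrite mulrC divfK // gt_eqF.
  by rewrite ler_pM // lerDl.
have lo := cP (v i).
have up : quad_form (G p) (v i) <= N * `|G p| * `|v i| ^+ 2.
  apply: le_trans (ler_norm _) _; apply: le_trans (quad_form_bound _ _) _.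
  by rewrite ler_wpM2r ?exprn_ge0 // ler_wpM2r // lerDl.
move: d lo up; rewrite ler_norml => /andP[d1 d2] lo up.
have sq : 0 <= `|v i| ^+ 2 by rewrite exprn_ge0.
set P := N * `|G p| in up *; clearbody P.
by apply/andP; split; clear -d1 d2 lo up sq; lra.
Qed.

End metric.

(** * Smooth paths and their length *)

Lemma within_continuous_reparam (S T U : topologicalType) (D : set T) (E : set S)
    (f : T -> U) (s : S -> T) :
  continuous s -> (forall u, E u -> D (s u)) ->
  {within D, continuous f} -> {within E, continuous (f \o s)}.
Proof.
move=> cs ED /subspace_continuousP cf; apply/subspace_continuousP => u Eu.
have cfu := cf _ (ED _ Eu); move=> A nA; have := cfu A nA.
rewrite /= !nbhs_simpl /= => h; have := cs u _ h; rewrite /= nbhs_simpl /=.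
by apply: filterS => v /= hv Ev; apply: hv; exact: ED.
Qed.

Section affine_reparametrization.
Context (R : realType).

Lemma affine_continuous (al be : R) : continuous (fun u => al * u + be).
Proof.
move=> u; apply: cvgD; last exact: cvg_cst.
by apply: cvgM; [exact: cvg_cst|exact: cvg_id].
Qed.

Lemma is_diff_within_affine (V : normedModType R) (D E : set R) (f : R -> V)
    (al be u : R) (L : {linear R -> V}) :
  (forall y, E y -> D (al * y + be)) ->
  is_diff_within D f (al * u + be) L ->
  exists2 K : {linear R -> V}, (forall r, K r = L (al * r)) &
    is_diff_within E (f \o (fun y => al * y + be)) u K.
Proof.
move=> ED dL.
have [A AE] := scaling_linear_exists al.
have [K KE] := linear_comp_exists A L.
exists K; first by move=> r; rewrite KE AE [r *: al]mulrC.
have [CL CL0 LC] := linear_real_bounded L; have [CA CA0 AC] := linear_real_bounded A.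
apply: (is_diff_within_comp AC LC CA0 CL0 KE ED _ dL).
move=> e e0; apply: nearW => y.
rewrite AE [_ *: al]mulrC opprD addrACA subrr addr0 -mulrBr subrr normr0.
by rewrite mulr_ge0 // ltW.
Qed.

Lemma C1_on_affine (V : normedModType R) (D E : set R) (f : R -> V) (al be : R) :
  (forall y, E y -> D (al * y + be)) ->
  C1_on D f -> C1_on E (f \o (fun y => al * y + be)).
Proof.
move=> ED [df dfP dfc].
have ex u : exists K : {linear R -> V}, E u ->
    (forall r, K r = df (al * u + be) (al * r)) /\
    is_diff_within E (f \o (fun y => al * y + be)) u K.
  have [Eu|nE] := pselect (E u); last by exists (df u).
  by have [K KE dK] := is_diff_within_affine ED (dfP _ (ED _ Eu)); exists K.
have [K KP] := choice ex; exists K.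
  by move=> u Eu; have [] := KP u Eu.
move=> h; apply: (@subspace_eq_continuous _ _ _
    ((fun u => df u (al * h)) \o (fun y => al * y + be))).
  by move=> u; rewrite inE => Eu; have [e _] := KP u Eu; exact: (esym (e h)).
by apply: (within_continuous_reparam (@affine_continuous al be) ED).
Qed.

Lemma C1_on_subset (V : normedModType R) (D E : set R) (f : R -> V) :
  E `<=` D -> C1_on D f -> C1_on E f.
Proof.
move=> ED [df dfP dfc]; exists df; last by move=> h; exact: continuous_subspaceW (dfc h).
by move=> x /ED Dx; apply: is_diff_within_subset (dfP x Dx).
Qed.

Lemma C1_on_eq (V : normedModType R) (D : set R) (f h : R -> V) :
  {in D, f =1 h} -> C1_on D f -> C1_on D h.
Proof.
move=> fh [df dfP dfc]; exists df => // x Dx.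
by apply: (is_diff_within_eq fh Dx); exact: dfP.
Qed.

End affine_reparametrization.

Section smooth_chains.
Context (R : realType) (m : nat) (M : C1_manifold R m).
Implicit Types (gam : R -> M) (a b c : R).

Definition smooth_arc gam a b := [/\ a < b, {within `[a, b], continuous gam} &
  forall i : atlas_index M,
    C1_on (`[a, b]%classic `&` gam @^-1` chart_dom (atlas i)) (fun u => atlas i (gam u))].

(** Binary concatenation replaces subdivision sequences, so facts about lengths are proved for one
    arc and extended by induction. *)
Inductive smooth_chain gam : R -> R -> Prop :=
| chain_arc a b of smooth_arc gam a b : smooth_chain gam a b
| chain_cat a b c of smooth_chain gam a b & smooth_chain gam b c : smooth_chain gam a c.

Lemma smooth_chain_lt gam a b : smooth_chain gam a b -> a < b.
Proof. by elim=> [{}a {}b []//|{}a c {}b _ ac _ cb]; apply: lt_trans cb. Qed.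

Lemma itv_split a b c : a <= b -> b <= c ->
  `[a, c]%classic = `[a, b]%classic `|` `[b, c]%classic.
Proof.
move=> ab bc; apply/seteqP; split => x /=; rewrite !in_itv /=.
  move=> /andP[ax xc]; have [xb|bx] := leP x b; [left|right]; rewrite ?ax ?xb //.
  by rewrite (ltW bx).
case=> /andP[h1 h2]; apply/andP; split => //.
  exact: le_trans h2 bc.
exact: le_trans ab h1.
Qed.

Lemma smooth_chain_continuous gam a b : smooth_chain gam a b ->
  {within `[a, b], continuous gam}.
Proof.
elim=> [{}a {}b []//|{}a c {}b ac cac cb ccb].
rewrite (itv_split (ltW (smooth_chain_lt ac)) (ltW (smooth_chain_lt cb))).
by apply: withinU_continuous => //; exact: itv_closed.
Qed.

Lemma smooth_arc_subset gam a b a' b' : a <= a' -> a' < b' -> b' <= b ->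
  smooth_arc gam a b -> smooth_arc gam a' b'.
Proof.
move=> aa ab bb [_ cg C1]; have sub : `[a', b']%classic `<=` `[a, b]%classic.
  by apply: subset_itv; rewrite bnd_simp.
split => //; first exact: continuous_subspaceW cg.
by move=> i; apply: C1_on_subset (C1 i); exact: setSI.
Qed.

Lemma smooth_arc_eq gam del a b : {in `[a, b], gam =1 del} ->
  smooth_arc gam a b -> smooth_arc del a b.
Proof.
move=> e [ab cg C1].
have e' : {in `[a, b]%classic, gam =1 del} by move=> x; rewrite inE => /e.
split => //; first exact: subspace_eq_continuous e' cg.
move=> i.
have -> : `[a, b]%classic `&` del @^-1` chart_dom (atlas i) =
    `[a, b]%classic `&` gam @^-1` chart_dom (atlas i).
  by apply/seteqP; split => x /= [xab]; rewrite e.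
by apply: C1_on_eq (C1 i) => x; rewrite inE => -[/= xab _]; rewrite e.
Qed.

Lemma smooth_chain_eq gam del a b : {in `[a, b], gam =1 del} ->
  smooth_chain gam a b -> smooth_chain del a b.
Proof.
move=> + ch; elim: ch => [{}a {}b arc e|{}a c {}b ac IH1 cb IH2 e].
  by apply: chain_arc; exact: smooth_arc_eq e arc.
have lac := ltW (smooth_chain_lt ac); have lcb := ltW (smooth_chain_lt cb).
apply: (chain_cat (IH1 _) (IH2 _)) => x xI; apply: e.
  by move: xI; rewrite !in_itv /= => /andP[-> h]; exact: le_trans h lcb.
by move: xI; rewrite !in_itv /= => /andP[h ->]; rewrite (le_trans lac h).
Qed.

Lemma smooth_arc_affine gam a b (al be : R) a' b' : a' < b' ->
  (forall u, u \in `[a', b'] -> al * u + be \in `[a, b]) ->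
  smooth_arc gam a b -> smooth_arc (fun u => gam (al * u + be)) a' b'.
Proof.
move=> ab' sub [_ cg C1]; split => //.
  exact: (within_continuous_reparam (@affine_continuous _ al be) sub cg).
by move=> i; apply: (C1_on_affine _ (C1 i)) => y /= [/sub yab yd].
Qed.

Lemma smooth_chain_affine gam a b (al be : R) : 0 < al -> smooth_chain gam a b ->
  smooth_chain (fun u => gam (al * u + be)) ((a - be) / al) ((b - be) / al).
Proof.
move=> al0; elim=> [{}a {}b arc|{}a c {}b _ IH1 _]; last exact: chain_cat IH1.
apply: chain_arc; apply: smooth_arc_affine (arc).
  by rewrite ltr_pM2r ?invr_gt0 // ltrD2r; case: arc.
move=> u; rewrite !in_itv /= ler_pdivrMr // ler_pdivlMr //.
by rewrite lerBlDr lerBrDr mulrC.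
Qed.

Lemma smooth_chain_reverse gam a b : smooth_chain gam a b ->
  smooth_chain (fun u => gam (- u)) (- b) (- a).
Proof.
elim=> [{}a {}b arc|{}a c {}b _ IH1 _ IH2]; last exact: chain_cat IH2 IH1.
apply: chain_arc; apply: (@smooth_arc_eq (fun u => gam (-1 * u + 0))).
  by move=> u _; rewrite mulN1r addr0.
apply: smooth_arc_affine (arc); first by rewrite ltrN2; case: arc.
by move=> u; rewrite !in_itv /= mulN1r addr0 lerNl lerNr andbC.
Qed.

Lemma smooth_chain_restrict gam a b c : smooth_chain gam a b -> a < c -> c <= b ->
  smooth_chain gam a c.
Proof.
elim=> [{}a {}b arc ac cb|{}a d {}b ad IH1 db IH2 ac cb].
  by apply: chain_arc; exact: smooth_arc_subset arc.
have [cd|dc] := leP c d; first exact: IH1.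
exact: chain_cat ad (IH2 dc cb).
Qed.

Lemma piecewise_C1_chain gam : piecewise_C1 gam -> smooth_chain gam 0 1.
Proof.
move=> [cg [n [t [t0 tn tinc C1]]]].
have tle i j : (i <= j)%N -> (j <= n)%N -> t i <= t j.
  move=> ij; rewrite -(subnK ij); elim: (j - i)%N => [//|k IH].
  rewrite addSn => kn; apply: le_trans (IH (ltnW kn)) (ltW (tinc _ kn)).
have n0 : (0 < n)%N.
  by case: n tn {tinc C1 tle} => // t1; have := oner_neq0 R; rewrite -t1 t0 eqxx.
rewrite -t0 -tn.
suff h : forall k, (0 < k)%N -> (k <= n)%N -> smooth_chain gam (t 0%N) (t k).
  exact: h.
have arc l : (l < n)%N -> smooth_arc gam (t l) (t l.+1).
  move=> kn; split; [exact: tinc| |exact: C1].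
  apply: continuous_subspaceW cg; apply: subset_itv; rewrite bnd_simp.
    by rewrite -t0; apply: tle => //; exact: ltnW.
  by rewrite -tn; apply: tle.
case=> [//|k _]; elim: k => [|k IH] kn; first by apply: chain_arc; exact: arc.
by apply: chain_cat (IH (ltnW kn)) _; apply: chain_arc; exact: arc.
Qed.

Lemma smooth_chain_piecewise gam : smooth_chain gam 0 1 -> piecewise_C1 gam.
Proof.
move=> ch; split; first exact: smooth_chain_continuous ch.
elim: ch => [a b [ab _ C1]|a c b ac [n1 [t1 [s1 e1 i1 d1]]] cb [n2 [t2 [s2 e2 i2 d2]]]].
  exists 1%N, (fun k => if k is 0%N then a else b).
  by split => // -[|k].
exists (n1 + n2)%N, (fun k => if (k <= n1)%N then t1 k else t2 (k - n1)%N).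
have step k : (k < n1 + n2)%N ->
  (k < n1)%N \/ exists2 l, (l < n2)%N & k = (n1 + l)%N.
  move=> kn; have [|nk] := ltnP k n1; [by left|right].
  by exists (k - n1)%N; rewrite ?subnKC // ltn_subLR.
(* At the joint [n1] the first branch is taken, and the two subdivisions agree there. *)
have tE l : (if (n1 + l <= n1)%N then t1 (n1 + l)%N else t2 (n1 + l - n1)%N) = t2 l.
  rewrite addKn; case: l => [|l]; first by rewrite addn0 leqnn e1 s2.
  by rewrite -[X in (_ <= X)%N]addn0 leq_add2l.
split => //.
- by rewrite tE.
- move=> k /step[kn1|[l ln2 ->]]; first by rewrite (ltnW kn1) kn1; exact: i1.
  by rewrite -addnS !tE; exact: i2.
- move=> k /step[kn1|[l ln2 ->]] i; first by rewrite (ltnW kn1) kn1; exact: d1.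
  by rewrite -addnS !tE; exact: d2.
Qed.

End smooth_chains.

(** * Affine change of variables in Lebesgue integrals *)

Section affine_substitution.
Context (R : realType).
Local Notation leb := (@lebesgue_measure R).
Variables al be : R.
Hypothesis al0 : al != 0.
Let s (u : R) : R := al * u + be.

Lemma measurable_affine :
  measurable_fun [set: measurableTypeR R] (s : _ -> measurableTypeR R).
Proof. exact: (continuous_measurable_fun (@affine_continuous R al be)). Qed.

Let push : {measure set (measurableTypeR R) -> \bar R} :=
  measure_function_pushforward__canonical__measure_function_Measure leb measurable_affine.

Let nal : {nonneg R} := NngNum (normr_ge0 al).

Lemma preimage_affine_itv (x y : R) : leb (s @^-1` `]x, y]) = leb
  (if 0 < al then `](x - be) / al, (y - be) / al] else `[(y - be) / al, (x - be) / al[)%classic.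
Proof.
congr (leb _); apply/seteqP; case: ifPn => al1; split => u /=; rewrite !in_itv /= /s.
- by rewrite ltr_pdivrMr // ler_pdivlMr // ltrBlDr lerBrDr mulrC.
- by rewrite ltr_pdivrMr // ler_pdivlMr // ltrBlDr lerBrDr mulrC.
- have an : al < 0 by rewrite lt_neqAle al0 leNgt.
  by rewrite ler_ndivrMr // ltr_ndivlMr // ltrBlDr lerBrDr mulrC andbC.
have an : al < 0 by rewrite lt_neqAle al0 leNgt.
by rewrite ler_ndivrMr // ltr_ndivlMr // ltrBlDr lerBrDr mulrC andbC.
Qed.

(** The push-forward scaled by [|al|] agrees with Lebesgue measure on half-open intervals, hence
    everywhere by uniqueness. Negative [al] is included for the reversal of paths. *)
Lemma lebesgue_measure_affine (A : set (measurableTypeR R)) : measurable A ->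
  leb A = (`|al|%:E * leb (s @^-1` A))%E.
Proof.
move=> mA.
have H := @lebesgue_measure_unique R (mscale nal push).
have H1 := H _ A mA.
suff H2 : forall X, ocitv X -> leb X = mscale nal push X by exact (H1 H2).
move=> _ [[x y] /= _ <-]; rewrite /mscale /= /pushforward preimage_affine_itv.
rewrite lebesgue_measure_itv /=.
have [al1|al1] := ltP 0 al; rewrite lebesgue_measure_itv /=.
  rewrite !lte_fin ltr_pM2r ?invr_gt0 // ltrD2r; case: ifP => _; last by rewrite mule0.
  by rewrite gtr0_norm // -!EFinB -EFinM -mulrBl mulrC divfK // opprB addrA subrK.
have an : al < 0 by rewrite lt_neqAle al0.
rewrite !lte_fin ltr_nM2r ?invr_lt0 // ltrD2r; case: ifP => _; last by rewrite mule0.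
rewrite ltr0_norm // -!EFinB -EFinM; congr EFin.
by rewrite -mulrBl mulNr mulrC divfK // !opprB addrA subrK.
Qed.

Lemma ge0_integral_affine (D : set (measurableTypeR R))
    (f : measurableTypeR R -> \bar R) :
  measurable D -> measurable_fun D f -> (forall x, D x -> (0 <= f x)%E) ->
  (\int[leb]_(x in D) f x = `|al|%:E * \int[leb]_(u in s @^-1` D) f (s u))%E.
Proof.
move=> mD mf f0.
rewrite (@eq_measure_integral _ _ _ D (mscale nal push) leb); last first.
  by move=> A mA _; exact: lebesgue_measure_affine.
rewrite ge0_integral_mscale //; congr (_ * _)%E.
rewrite ge0_integral_pushforward //; first exact: measurable_affine.
by move=> x; rewrite inE; exact: f0.
Qed.

End affine_substitution.

Section speed.
Context (R : realType) (m : nat) (M : C1_manifold R m) (g : riemannian_metric M).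
Implicit Types (gam : R -> M) (a b c u : R).

Definition speed gam u : R := Num.sqrt (g (gam u) (velocity gam u) (velocity gam u)).

Lemma smooth_arc_continuous_at gam a b u : smooth_arc gam a b -> u \in `]a, b[ ->
  {for u, continuous gam}.
Proof.
move=> [ab cg _] uab.
have : {within `]a, b[, continuous gam}.
  by apply: continuous_subspaceW cg; exact: subset_itvW.
rewrite continuous_open_subspace; last exact: itv_open.
by apply; rewrite inE.
Qed.

Lemma smooth_arc_nbhs gam a b u (U : set M) : smooth_arc gam a b -> u \in `]a, b[ ->
  nbhs (gam u) U -> nbhs u (`]a, b[%classic `&` gam @^-1` U).
Proof.
move=> arc uab nU; apply: filterI.
  by apply: open_nbhs_nbhs; split => //; exact: itv_open.
exact: (smooth_arc_continuous_at (arc) uab) nU.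
Qed.

Lemma velocityE gam u i (D : set R) (L : {linear R -> 'rV[R]_m}) :
  chart_dom (atlas i) (gam u) -> nbhs u D ->
  is_diff_within D (fun v => atlas i (gam v)) u L -> velocity gam u i = L 1.
Proof.
move=> iu nD dL; rewrite /velocity asboolT // derive1E.
by have [] := is_diff_within_derive1 nD dL.
Qed.

(** The velocity is a two-sided derivative, so it is identified only inside the interval; [df]
    continues it to the endpoints, as the fundamental theorem of calculus will require. *)
Lemma smooth_arc_velocity gam a b i : smooth_arc gam a b ->
  exists df : R -> {linear R -> 'rV[R]_m},
    (forall u, u \in `]a, b[ -> chart_dom (atlas i) (gam u) ->
      is_diff_within (`]a, b[%classic `&` gam @^-1` chart_dom (atlas i))
        (fun v => atlas i (gam v)) u (df u) /\ velocity gam u i = df u 1) /\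
    {within `[a, b]%classic `&` gam @^-1` chart_dom (atlas i),
      continuous (fun u => df u 1)}.
Proof.
move=> arc; have [_ _ C1] := arc; have [df dfP dfc] := C1 i.
exists df; split => // u uab iu.
have d : is_diff_within (`]a, b[%classic `&` gam @^-1` chart_dom (atlas i))
    (fun v => atlas i (gam v)) u (df u).
  apply: is_diff_within_subset (dfP u _); first by apply: setSI; exact: subset_itvW.
  by split => //=; apply: subset_itvW uab.
by split => //; apply: velocityE d => //; apply: smooth_arc_nbhs (arc) _ _ => //; exact: nbhs_chart_dom.
Qed.

(** Near [u] the curve read in chart [j] is the transition applied to the curve read in chart [i],
    so the chain rule gives the transformation law. *)
Lemma velocity_tangent gam a b u : smooth_arc gam a b -> u \in `]a, b[ ->
  tangent (gam u) (velocity gam u).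
Proof.
move=> arc uab; split=> [i nd|i j iu ju]; first by rewrite /velocity asboolF.
have [L LP] := transition_diff iu ju; exists L => //.
have [df [dfP _]] := smooth_arc_velocity i arc.
have [d ->] := dfP u uab iu.
have [KL KLE] := linear_comp_exists (df u) L.
have [CL CL0 LC] := linear_row_bounded L.
have [CA CA0 AC] := linear_real_bounded (df u).
rewrite -KLE.
pose D := `]a, b[%classic `&` gam @^-1` (chart_dom (atlas i) `&` chart_dom (atlas j)).
have nD : nbhs u D.
  by apply: smooth_arc_nbhs (arc) uab _; apply: filterI; exact: nbhs_chart_dom.
apply: (velocityE ju nD).
apply: (@is_diff_within_eq _ _ _ _
    (transition (atlas i) (atlas j) \o (fun v => atlas i (gam v)))).
- by move=> v; rewrite inE => -[_ [iv jv]] /=; rewrite transitionE.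
- exact: nbhs_singleton nD.
apply: (is_diff_within_comp AC LC CA0 CL0 KLE _ _ LP).
- by move=> v [_ [iv jv]]; exists (gam v).
by apply: is_diff_within_subset d => v [vab [iv jv]].
Qed.

(** Near [u] the curve stays in one chart, where the speed is the square root of the Gram form at
    the coordinate derivative, and both of these vary continuously. *)
Lemma speed_continuous gam a b u : smooth_arc gam a b -> u \in `]a, b[ ->
  {for u, continuous (speed gam)}.
Proof.
move=> arc uab; have [i iu] := atlas_cover (gam u).
have [df [dfP dfc]] := smooth_arc_velocity i arc.
have [G cG GE] := inner_continuous g i.
pose D := `]a, b[%classic `&` gam @^-1` chart_dom (atlas i).
have nD : nbhs u D by apply: smooth_arc_nbhs (arc) uab _; exact: nbhs_chart_dom.
have spE v : D v -> speed gam v = Num.sqrt (quad_form (G (gam v)) (df v 1)).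
  move=> [vab iv]; have [_ e] := dfP v vab iv.
  have tv := velocity_tangent arc vab.
  by rewrite /speed (GE _ _ _ iv tv tv) e.
rewrite /prop_for /continuous_at spE; last exact: nbhs_singleton nD.
have cv : (fun v => Num.sqrt (quad_form (G (gam v)) (df v 1))) @ u -->
    Num.sqrt (quad_form (G (gam u)) (df u 1)).
  apply: (cvg_comp (fun v => quad_form (G (gam v)) (df v 1)) Num.sqrt);
    last exact: sqrt_continuous.
  apply: cvg_quad_form.
    apply: (cvg_comp gam G); first exact: smooth_arc_continuous_at (arc) uab.
    move: cG; rewrite continuous_open_subspace; last exact: chart_dom_open.
    by apply; rewrite inE.
  have cdf : {within D, continuous (fun v => df v 1)}.
    by apply: continuous_subspaceW dfc; apply: setSI; exact: subset_itvW.
  move: cdf => /subspace_continuousP /(_ u (nbhs_singleton nD)).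
  by rewrite within_interior.
apply: cvg_trans cv; apply: near_eq_cvg.
by apply: filterS nD => v Dv; rewrite spE.
Qed.

Lemma speed_ge0 gam u : 0 <= speed gam u.
Proof. exact: sqrtr_ge0. Qed.

Lemma measurable_speed_arc gam a b : smooth_arc gam a b ->
  measurable_fun `]a, b[ (speed gam).
Proof.
move=> arc; apply: open_continuous_measurable_fun; first exact: itv_open.
by move=> u; rewrite inE => uab; exact: speed_continuous (arc) uab.
Qed.

Lemma measurable_speed gam a b : smooth_chain gam a b ->
  measurable_fun `[a, b] (speed gam).
Proof.
elim=> [{}a {}b arc|{}a c {}b ac IH1 cb IH2].
  exact: measurable_fun_itv_cc (measurable_speed_arc arc).
rewrite (itv_split (ltW (smooth_chain_lt ac)) (ltW (smooth_chain_lt cb))).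
by apply/measurable_funU => //; split.
Qed.

Definition arc_length gam a b : \bar R :=
  (\int[lebesgue_measure]_(u in `[a, b]) (speed gam u)%:E)%E.

Lemma arc_length_open gam a b : smooth_arc gam a b ->
  arc_length gam a b = (\int[lebesgue_measure]_(u in `]a, b[) (speed gam u)%:E)%E.
Proof.
move=> arc; rewrite /arc_length integral_itv_bndoo //.
by apply/measurable_EFinP; exact: measurable_speed_arc.
Qed.

Lemma arc_length_ge0 gam a b : (0 <= arc_length gam a b)%E.
Proof. by apply: integral_ge0 => u _; rewrite lee_fin speed_ge0. Qed.

Lemma arc_length_cat gam a b c : smooth_chain gam a b -> smooth_chain gam b c ->
  arc_length gam a c = (arc_length gam a b + arc_length gam b c)%E.
Proof.
move=> ab bc; have mac := measurable_speed (chain_cat ab bc).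
have lab := smooth_chain_lt ab; have lbc := smooth_chain_lt bc.
have e : `[a, c]%classic = `[a, b[%classic `|` `[b, c]%classic :> set R.
  apply/seteqP; split => x /=; rewrite !in_itv /=.
    move=> /andP[ax xc]; have [bx|xb] := leP b x; [right|left]; rewrite ?ax ?bx //.
  case=> /andP[h1 h2]; apply/andP; split => //.
    by apply: ltW; exact: lt_trans h2 lbc.
  by apply: le_trans h1; exact: ltW.
rewrite /arc_length e ge0_integral_setU //.
- congr (_ + _)%E; apply: integral_itv_bndo_bndc.
  apply/measurable_EFinP; apply: measurable_funS mac => //.
  by apply: subset_itv; rewrite bnd_simp // ltW.
- by rewrite -e; apply/measurable_EFinP.
- by move=> x _; rewrite lee_fin speed_ge0.
rewrite disj_set2E; apply/eqP/seteqP; split => // x [] /=; rewrite !in_itv /=.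
by move=> /andP[_ xb] /andP[bx _]; move: xb; rewrite ltNge bx.
Qed.

Lemma arc_length_restrict gam a b c : smooth_chain gam a b -> a < c -> c <= b ->
  (arc_length gam a c <= arc_length gam a b)%E.
Proof.
move=> ab ac cb; apply: ge0_subset_integral => //.
- by apply/measurable_EFinP; exact: measurable_speed.
- by move=> u _; rewrite lee_fin speed_ge0.
- by apply: subset_itv; rewrite bnd_simp.
Qed.

(** Outside the interval the paths may differ, and so may their derivatives at the ends of an arc;
    the comparison is made on open intervals, which carry the whole integral. *)
Lemma arc_length_eq gam del a b : {in `[a, b], gam =1 del} ->
  smooth_chain gam a b -> arc_length gam a b = arc_length del a b.
Proof.
move=> + ch; elim: ch => [{}a {}b arc e|{}a c {}b ac IH1 cb IH2 e].
  have arc' := smooth_arc_eq e arc.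
  rewrite (arc_length_open arc) (arc_length_open arc'); apply: eq_integral => u; rewrite inE /= => uab.
  have nab : nbhs u `]a, b[%classic by apply: open_nbhs_nbhs; split => //; exact: itv_open.
  have eq0 : gam u = del u by apply: e; exact: subset_itvW uab.
  rewrite /speed; suff -> : velocity gam u = velocity del u by rewrite eq0.
  apply/funext => i; rewrite /velocity eq0; case: asboolP => // iu.
  rewrite !derive1E; apply: near_eq_derive.
  by apply: filterS nab => v vab; rewrite e //; exact: subset_itvW vab.
have lac := ltW (smooth_chain_lt ac); have lcb := ltW (smooth_chain_lt cb).
have e1 : {in `[a, c], gam =1 del}.
  move=> x; rewrite in_itv /= => /andP[h1 h2]; apply: e.
  by rewrite in_itv /= h1 (le_trans h2 lcb).
have e2 : {in `[c, b], gam =1 del}.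
  move=> x; rewrite in_itv /= => /andP[h1 h2]; apply: e.
  by rewrite in_itv /= h2 (le_trans lac h1).
rewrite (arc_length_cat ac cb) (IH1 e1) (IH2 e2).
by rewrite -(arc_length_cat (smooth_chain_eq e1 ac) (smooth_chain_eq e2 cb)).
Qed.

Lemma speed_affine gam a b (al be : R) u : smooth_arc gam a b ->
  al * u + be \in `]a, b[ ->
  speed (fun v => gam (al * v + be)) u = `|al| * speed gam (al * u + be).
Proof.
move=> arc sab; have tv := velocity_tangent arc sab; rewrite /speed.
suff -> : velocity (fun v => gam (al * v + be)) u = al *: velocity gam (al * u + be).
  by rewrite innerZZ // sqrtrM ?sqr_ge0 // sqrtr_sqr.
apply/funext => i; rewrite [RHS](_ : _ = al *: velocity gam (al * u + be) i) //.
have [is_|nis] := pselect (chart_dom (atlas i) (gam (al * u + be))); last first.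
  by rewrite /velocity !asboolF // scaler0.
have [df [dfP _]] := smooth_arc_velocity i arc.
have [d ->] := dfP _ sab is_.
pose D := `]a, b[%classic `&` gam @^-1` chart_dom (atlas i).
have nD : nbhs (al * u + be) D.
  by apply: smooth_arc_nbhs (arc) sab _; exact: nbhs_chart_dom.
have [K KE dK] := @is_diff_within_affine R _ D ((fun v => al * v + be) @^-1` D)
  _ al be u _ (fun _ h => h) d.
have nE : nbhs u ((fun v => al * v + be) @^-1` D) := affine_continuous nD.
by rewrite (velocityE is_ nE dK) KE mulr1 -linearZ; congr (df _ _); rewrite -[LHS]mulr1.
Qed.

(** The speed is multiplied by [|al|], which cancels against the factor from the change of
    variables. *)
Lemma arc_length_affine_arc gam a b (al be : R) a' b' : al != 0 ->
  (fun u => al * u + be) @^-1` `]a, b[ = `]a', b'[%classic ->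
  smooth_arc gam a b -> smooth_arc (fun u => gam (al * u + be)) a' b' ->
  arc_length (fun u => gam (al * u + be)) a' b' = arc_length gam a b.
Proof.
move=> al0 pre arc arc'; rewrite (arc_length_open arc) (arc_length_open arc').
rewrite [RHS](ge0_integral_affine be al0) //; last 2 first.
- by apply/measurable_EFinP; exact: measurable_speed_arc.
- by move=> u _; rewrite lee_fin speed_ge0.
have nal : 0 < `|al| by rewrite normr_gt0.
have pre' u : `]a', b'[%classic u -> al * u + be \in `]a, b[ by rewrite -pre.
rewrite pre.
have -> : (\int[lebesgue_measure]_(u in `]a', b'[) (speed gam (al * u + be))%:E =
    \int[lebesgue_measure]_(u in `]a', b'[) ((`|al|^-1)%:E *
      (speed (fun u => gam (al * u + be)) u)%:E))%E.
  apply: eq_integral => u /set_mem uab.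
  by rewrite -EFinM (speed_affine (arc) (pre' _ uab)) mulKf // gt_eqF.
rewrite ge0_integralZl //.
- by rewrite muleA -EFinM mulfV ?gt_eqF // mul1e.
- by apply/measurable_EFinP; exact: measurable_speed_arc.
- by move=> u _; rewrite lee_fin speed_ge0.
Qed.

End speed.

(** * The geodesic distance *)

Section geodesic_distance.
Context (R : realType) (m : nat) (M : C1_manifold R m) (g : riemannian_metric M).
Implicit Types (gam : R -> M) (a b c u : R) (x y z p : M).

Local Notation arc_length := (arc_length g).
Local Notation rho := (geodesic_dist g).

Lemma arc_length_affine gam a b (al be : R) : 0 < al -> smooth_chain gam a b ->
  arc_length (fun u => gam (al * u + be)) ((a - be) / al) ((b - be) / al) =
  arc_length gam a b.
Proof.
move=> al0; elim=> [{}a {}b arc|{}a c {}b ac IH1 cb IH2].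
  have ab : a < b by case: arc.
  apply: (@arc_length_affine_arc _ _ _ g gam a b) => //.
  - by rewrite gt_eqF.
  - apply/seteqP; split => u /=; rewrite !in_itv /= ltr_pdivrMr // ltr_pdivlMr //;
    by rewrite ltrBlDr ltrBrDr mulrC.
  apply: (smooth_arc_affine _ _ arc); first by rewrite ltr_pM2r ?invr_gt0 // ltrD2r.
  move=> u; rewrite !in_itv /= ler_pdivrMr // ler_pdivlMr //.
  by rewrite lerBlDr lerBrDr mulrC.
rewrite (arc_length_cat g ac cb) -IH1 -IH2.
by apply: arc_length_cat; exact: smooth_chain_affine.
Qed.

Lemma arc_length_reverse gam a b : smooth_chain gam a b ->
  arc_length (fun u => gam (- u)) (- b) (- a) = arc_length gam a b.
Proof.
have negE gam' : (fun u => gam' (- u)) = (fun u => gam' (-1 * u + 0)) :> (R -> M).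
  by apply/funext => u; rewrite mulN1r addr0.
elim=> [{}a {}b arc|{}a c {}b ac IH1 cb IH2].
  have ab : a < b by case: arc.
  rewrite negE; apply: (@arc_length_affine_arc _ _ _ g gam a b) => //.
  - by apply/seteqP; split => u /=; rewrite !in_itv /= mulN1r addr0 ltrNl ltrNr andbC.
  apply: (smooth_arc_affine _ _ arc); first by rewrite ltrN2.
  by move=> u; rewrite !in_itv /= mulN1r addr0 lerNl lerNr andbC.
rewrite (arc_length_cat g ac cb) -IH1 -IH2 addeC.
by apply: arc_length_cat; exact: smooth_chain_reverse.
Qed.

Lemma geodesic_dist_ge0 x y : (0 <= rho x y)%E.
Proof. by apply/ereal_infP => _ [gam _ <-]; exact: arc_length_ge0. Qed.

Lemma geodesic_dist_le_arc gam a b : smooth_chain gam a b ->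
  (rho (gam a) (gam b) <= arc_length gam a b)%E.
Proof.
move=> ch; have ab := smooth_chain_lt ch.
have al0 : 0 < b - a by rewrite subr_gt0.
have e0 : (a - a) / (b - a) = 0 by rewrite subrr mul0r.
have e1 : (b - a) / (b - a) = 1 by rewrite divff // gt_eqF.
have := smooth_chain_affine a al0 ch; have := arc_length_affine a al0 ch.
rewrite e0 e1 => <- ch'.
apply: ereal_inf_lbound; exists (fun u => gam ((b - a) * u + a)) => //; split.
- exact: smooth_chain_piecewise.
- by rewrite mulr0 add0r.
- by rewrite mulr1 subrK.
Qed.

Lemma geodesic_dist_lt_arc x y (r : R) : (rho x y < r%:E)%E ->
  exists gam, [/\ smooth_chain gam 0 1, gam 0 = x, gam 1 = y &
    (arc_length gam 0 1 < r%:E)%E].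
Proof.
move=> /ereal_inf_lt[_ [gam [pc g0 g1] <-] len].
by exists gam; split => //; exact: piecewise_C1_chain.
Qed.

Lemma geodesic_dist_sym_le x y : (rho y x <= rho x y)%E.
Proof.
apply/ereal_infP => _ [gam [/piecewise_C1_chain ch <- <-] <-].
have := geodesic_dist_le_arc (smooth_chain_reverse ch).
by rewrite (arc_length_reverse ch) !oppr0 opprK.
Qed.

Lemma geodesic_dist_sym x y : rho x y = rho y x.
Proof. by apply/eqP; rewrite eq_le !geodesic_dist_sym_le. Qed.

(** Concatenate two paths that realize the strict bounds, the second one shifted to [[1, 2]]. The
    triangle inequality and the openness of balls both follow from this strict form. *)
Lemma geodesic_dist_lt_add x y z (r s : R) : (rho x y < r%:E)%E -> (rho y z < s%:E)%E ->
  (rho x z < (r + s)%:E)%E.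
Proof.
move=> /geodesic_dist_lt_arc[gam1 [ch1 x1 y1 l1]].
move=> /geodesic_dist_lt_arc[gam2 [ch2 y2 z2 l2]].
pose gam2' u := gam2 (1 * u + -1).
have [ch2' l2'] : smooth_chain gam2' 1 2 /\ arc_length gam2' 1 2 = arc_length gam2 0 1.
  have e1 : (0 - -1) / 1 = 1 :> R by rewrite divr1 sub0r opprK.
  have e2 : (1 - -1) / 1 = 2 :> R by rewrite divr1 opprK.
  have ch2' := smooth_chain_affine (-1) ltr01 ch2.
  have l2' := arc_length_affine (-1) ltr01 ch2.
  by rewrite e1 e2 in ch2' l2'; split; [exact ch2'|exact l2'].
pose del u := if u <= 1 then gam1 u else gam2' u.
have E1 : {in `[0, 1], gam1 =1 del}.
  by move=> u; rewrite in_itv /= /del => /andP[_ ->]; exact: erefl.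
have E2 : {in `[1, 2], gam2' =1 del}.
  move=> u; rewrite in_itv /= /del => /andP[u1 _]; case: ifP => [u1'|_]; last exact: erefl.
  have -> : u = 1 by apply: le_anti; rewrite u1 u1'.
  by rewrite /gam2' mulr1 subrr y2 y1.
have c1 := smooth_chain_eq E1 ch1; have c2 := smooth_chain_eq E2 ch2'.
have := geodesic_dist_le_arc (chain_cat c1 c2).
rewrite (arc_length_cat g c1 c2) -(arc_length_eq g E1 ch1) -(arc_length_eq g E2 ch2') l2'.
rewrite /del ler01 -[2]/(1 + 1) gerDl ler10 /gam2' mul1r addrK x1 z2.
by move=> /le_lt_trans; apply; rewrite EFinD lteD.
Qed.

Lemma geodesic_dist_triangle x y z : (rho x z <= rho x y + rho y z)%E.
Proof.
have := geodesic_dist_ge0 x y; have := geodesic_dist_ge0 y z.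
case E1 : (rho x y) => [r| |] //; case E2 : (rho y z) => [s| |] // _ _;
  rewrite ?addey ?addye ?leey //.
apply/lee_addgt0Pr => e e0; have e2 : 0 < e / 2 by rewrite divr_gt0.
apply: ltW; rewrite -!EFinD [e]splitr addrACA.
by apply: (@geodesic_dist_lt_add x y z); rewrite ?E1 ?E2 lte_fin ltrDl.
Qed.

Lemma segment_continuous (V : normedModType R) (v h : V) :
  continuous (fun u : R => v + u *: h).
Proof.
move=> u; apply: cvgD; first exact: cvg_cst.
by apply: cvgZ; [exact: cvg_id|exact: cvg_cst].
Qed.

Lemma segment_is_diff (V : normedModType R) (D : set R) (v h : V) u (L : {linear R -> V}) :
  (forall r, L r = r *: h) -> is_diff_within D (fun u : R => v + u *: h) u L.
Proof.
move=> LE e e0; apply: nearW => w.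
by rewrite LE opprD addrACA subrr add0r -scalerBl subrr normr0 mulr_ge0 // ltW.
Qed.

(** In chart [j] the path is the transition from [i] composed with a straight segment, so it is C1
    by the chain rule. *)
Lemma segment_smooth (i : atlas_index M) (v h : 'rV[R]_m) :
  let sig u := chart_inv (atlas i) (v + u *: h) in
  (forall u, u \in `[0, 1] -> chart_dom (atlas i) (sig u) /\ atlas i (sig u) = v + u *: h) ->
  smooth_arc sig 0 1.
Proof.
move=> sig sigP; split; first exact: ltr01.
  apply: (within_continuous_reparam (@segment_continuous _ v h) _
    (@chart_inv_continuous _ _ _ (atlas i))).
  by move=> u /sigP[d e]; exists (sig u).
move=> j; have [dT dTP dTc] := atlas_C1 i j.
pose D := `[0, 1]%classic `&` sig @^-1` chart_dom (atlas j).
have DT u : D u -> transition_dom (atlas i) (atlas j) (v + u *: h).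
  by move=> [/sigP[d e] ju]; exists (sig u).
have [S SE] := scaling_linear_exists h.
have ex u : exists K : {linear R -> 'rV[R]_m}, forall r, K r = dT (v + u *: h) (S r).
  exact: linear_comp_exists.
have [K KE] := choice ex; exists K.
  move=> u Du.
  have [CL CL0 LC] := linear_row_bounded (dT (v + u *: h)).
  have [CA CA0 AC] := linear_real_bounded S.
  apply: (@is_diff_within_comp _ _ _ _ D _ (fun u : R => v + u *: h)
    (transition (atlas i) (atlas j)) u S _ (K u) CA CL AC LC CA0 CL0 (KE u) DT).
    exact: segment_is_diff.
  exact: dTP (DT _ Du).
move=> r; have -> : (fun u => K u r) = (fun u => dT (v + u *: h) (S r)).
  by apply/funext => u; rewrite KE.
exact: (within_continuous_reparam (@segment_continuous _ v h) DT (dTc (S r))).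
Qed.

Lemma segment_length (i : atlas_index M) (v h : 'rV[R]_m) (C : R) :
  let sig u := chart_inv (atlas i) (v + u *: h) in
  0 <= C ->
  (forall u, u \in `[0, 1] -> [/\ chart_dom (atlas i) (sig u),
    atlas i (sig u) = v + u *: h &
    forall w, tangent (sig u) w -> g (sig u) w w <= C * `|w i| ^+ 2]) ->
  (arc_length sig 0 1 <= (Num.sqrt C * `|h|)%:E)%E.
Proof.
move=> sig C0 sigP.
have arc : smooth_arc sig 0 1 by apply: segment_smooth => u /sigP[].
rewrite (arc_length_open g arc).
have -> : (Num.sqrt C * `|h|)%:E =
    (\int[lebesgue_measure]_(u in `]0%R, 1%R[) (cst (Num.sqrt C * `|h|)%:E) u)%E.
  by rewrite integral_cst //= lebesgue_measure_itv /= lte_fin ltr01 oppr0 adde0 mule1.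
apply: ge0_le_integral => //.
- by move=> u _; rewrite lee_fin speed_ge0.
- by apply/measurable_EFinP; exact: measurable_speed_arc.
move=> u /= u01.
suff : speed g sig u <= Num.sqrt C * `|h| by rewrite -lee_fin.
have u01' : u \in `[0, 1] by exact: subset_itvW u01.
have [d e bound] := sigP u u01'.
have -> : Num.sqrt C * `|h| = Num.sqrt (C * `|h| ^+ 2).
  by rewrite sqrtrM // sqrtr_sqr normr_id.
rewrite /speed ler_wsqrtr //.
have [S SE] := scaling_linear_exists h.
have vi : velocity sig u i = h.
  rewrite -[h]scale1r -SE; apply: (velocityE d (D := `]0, 1[%classic)).
    by apply: open_nbhs_nbhs; split => //; exact: itv_open.
  apply: (is_diff_within_eq (f := fun u : R => v + u *: h)) => //.
    move=> w; rewrite inE => w01.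
    by have [|_ ->] := sigP w; first exact: subset_itvW w01.
  exact: segment_is_diff.
by rewrite -[in leRHS]vi; apply: bound; exact: velocity_tangent arc u01.
Qed.

(** The model is convex, so the straight segment between the images of [p] and [z] stays in the
    chart, also at the boundary, and its length is at most a constant times the coordinate
    distance. *)
Lemma geodesic_dist_near p (e : R) : 0 < e -> \forall z \near p, (rho p z < e%:E)%E.
Proof.
move=> e0; have [i ip] := atlas_cover p.
have [c [C [c0 C0 bounds]]] := gram_bounds g ip.
have [r r0 rP] := chart_inv_near ip bounds.
have s0 : 0 < Num.sqrt C by rewrite sqrtr_gt0.
have e'0 : 0 < Num.min r (e / Num.sqrt C) by rewrite lt_min r0 divr_gt0.
have := chart_map_near ip e'0; apply: filterS => z [iz].
rewrite lt_min ltr_pdivlMr // => /andP[zr ze].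
pose h := atlas i z - atlas i p.
have hE : `|h| = `|atlas i p - atlas i z| by rewrite distrC.
pose sig u := chart_inv (atlas i) (atlas i p + u *: h).
have sigP u : u \in `[0, 1] -> [/\ chart_dom (atlas i) (sig u),
    atlas i (sig u) = atlas i p + u *: h &
    forall w, tangent (sig u) w -> g (sig u) w w <= C * `|w i| ^+ 2].
  rewrite in_itv /= => /andP[u0 u1].
  have [||d eq [_ b]] := rP (atlas i p + u *: h).
  - by apply: model_convex => //; exact: chart_image_model.
  - rewrite opprD addNKr normrN normrZ ger0_norm // hE.
    by apply: le_lt_trans zr; rewrite ler_piMl.
  by split => // w tw; have /andP[] := b w tw.
have arc : smooth_arc sig 0 1 by apply: segment_smooth => u /sigP[].
have := geodesic_dist_le_arc (chain_arc arc).
rewrite {1}/sig scale0r addr0 {1}/sig scale1r addrC subrK !chart_mapK //.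
move=> /le_lt_trans; apply.
apply: le_lt_trans (segment_length (ltW C0) sigP) _.
by rewrite lte_fin mulrC hE.
Qed.

Lemma geodesic_ball_system : ball_system rho.
Proof.
split.
- move=> x; apply/eqP; rewrite eq_le geodesic_dist_ge0 andbT.
  apply/lee_addgt0Pr => e e0; rewrite add0e; apply: ltW.
  (* The point [x] belongs to each of its neighbourhoods, so it is at arbitrarily small distance
     from itself. *)
  exact: nbhs_singleton (geodesic_dist_near x e0).
- exact: geodesic_dist_ge0.
- exact: geodesic_dist_sym.
- exact: geodesic_dist_triangle.
move=> x r; rewrite openE => y /= xy.
have : exists2 e : R, 0 < e & (rho x y < (r - e)%:E)%E.
  move: xy; rewrite /dball /=; have := geodesic_dist_ge0 x y.
  case: (rho x y) => [s _|//|//]; rewrite lte_fin => sr.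
  exists ((r - s) / 2); first by rewrite divr_gt0 // subr_gt0.
  rewrite lte_fin ltrBrDr -ltrBrDl ltr_pdivrMr // ltr_pMr ?ltr1n //.
  by rewrite subr_gt0.
move=> [e e0 xy']; have := geodesic_dist_near y e0; apply: filterS => z yz.
by have := geodesic_dist_lt_add xy' yz; rewrite subrK.
Qed.

End geodesic_distance.

(** * Two points at positive geodesic distance *)

Section far_points.
Context (R : realType) (m : nat) (M : C1_manifold R m) (g : riemannian_metric M).
Implicit Types (gam : R -> M) (a b c u : R) (p q : M).

(** The fundamental theorem of calculus for one coordinate [F]: its derivative [f] is at most the
    norm of the velocity in the chart, which the lower bound [c] compares with the speed. *)
Lemma chart_coord_arc gam a b c (i : atlas_index M) (l : 'I_m) :
  0 <= c -> smooth_arc gam a b ->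
  (forall u, u \in `[a, b] -> chart_dom (atlas i) (gam u) /\
    forall v, tangent (gam u) v -> c * `|v i| ^+ 2 <= g (gam u) v v) ->
  ((Num.sqrt c * `|atlas i (gam b) 0 l - atlas i (gam a) 0 l|)%:E <=
    arc_length g gam a b)%E.
Proof.
move=> c0 arc domc; have [ab cg _] := arc.
have dom u : u \in `[a, b] -> chart_dom (atlas i) (gam u) by move=> /domc[].
have oc u : u \in `]a, b[ -> u \in `[a, b] by exact: subset_itvW.
have [df [dfP dfc]] := smooth_arc_velocity i arc.
have De : `[a, b]%classic `&` gam @^-1` chart_dom (atlas i) = `[a, b]%classic.
  by apply/seteqP; split => u /=; [case|move=> uab; split => //; exact: dom].
rewrite De in dfc.
pose F u := atlas i (gam u) 0 l; pose f u := df u 1 0 l.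
have cf : {within `[a, b], continuous f}.
  apply/subspace_continuousP => u uab; have /subspace_continuousP cd := dfc.
  exact: (cvg_comp _ (fun v : 'rV[R]_m => v 0 l) (cd u uab) (@coord_continuous _ _ _ 0 l _)).
have cF : {within `[a, b], continuous F}.
  apply/subspace_continuousP => u uab; move/subspace_continuousP : cg => /(_ u uab) cgu.
  apply: (cvg_comp (fun u => atlas i (gam u)) (fun v : 'rV[R]_m => v 0 l));
    last exact: coord_continuous.
  apply: (cvg_comp gam (atlas i) cgu).
  have := @chart_map_continuous _ _ _ (atlas i).
  rewrite continuous_open_subspace; last exact: chart_dom_open.
  by apply; rewrite inE; exact: dom.
have dF u : u \in `]a, b[ -> is_derive u 1 F (f u).
  move=> uab; have udom := dom u (oc _ uab).
  have [d _] := dfP u uab udom.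
  have [S SE] := scaling_linear_exists (f u).
  have dS : is_diff_within (`]a, b[%classic `&` gam @^-1` chart_dom (atlas i)) F u S.
    move=> e e0; have := d e e0; apply: filterS => v; apply: le_trans.
    have -> : F v - F u - S (v - u) = (atlas i (gam v) - atlas i (gam u) - df u (v - u)) 0 l.
      rewrite SE !mxE; congr (_ - _); have -> : v - u = (v - u) *: (1 : R) by rewrite [RHS]mulr1.
      by rewrite linearZ mxE [(v - u) *: 1]mulr1.
    exact: row_coord_le.
  have := is_diff_within_derive1 _ dS; rewrite SE scale1r; apply.
  by apply: smooth_arc_nbhs (arc) uab _; exact: nbhs_chart_dom.
have /(continuous_within_itvP _ ab)[_ Fa Fb] := cF.
have mf : measurable_fun `]a, b[ (EFin \o f).
  apply/measurable_EFinP; apply: (@measurable_funS _ _ _ _ `[a, b]) => //.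
  exact: subspace_continuous_measurable_fun.
have ftc : (\int[lebesgue_measure]_(x in `[a, b]) (f x)%:E = (F b)%:E - (F a)%:E)%E.
  apply: continuous_FTC2 => //.
    by split => // u uab; have [] := dF u uab.
  by move=> u uab; rewrite derive1E; have [] := dF u uab.
rewrite integral_itv_bndoo // in ftc.
rewrite -/(F b) -/(F a) EFinM.
have -> : (`|F b - F a|%:E = `|\int[lebesgue_measure]_(x in `]a, b[) (f x)%:E|)%E.
  by rewrite ftc.
have le1 := le_abse_integral lebesgue_measure (measurable_itv `]a, b[) mf.
apply: le_trans (lee_wpmul2l _ le1) _; first by rewrite lee_fin sqrtr_ge0.
have mf' : measurable_fun `]a, b[ (fun u => `|(f u)%:E|%E) by apply: measurableT_comp.
rewrite -ge0_integralZl //.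
rewrite (arc_length_open g arc); apply: ge0_le_integral => //.
- exact: (measurable_funeM _ mf').
- by apply/measurable_EFinP; exact: measurable_speed_arc.
move=> u uab.
suff : Num.sqrt c * `|f u| <= speed g gam u by rewrite -lee_fin.
have [_ e] := dfP u uab (dom u (oc _ uab)).
have [_ /(_ _ (velocity_tangent arc uab)) low] := domc u (oc _ uab).
apply: (@le_trans _ _ (Num.sqrt (c * `|velocity gam u i| ^+ 2))).
  rewrite sqrtrM // sqrtr_sqr normr_id ler_wpM2l ?sqrtr_ge0 // e.
  exact: row_coord_le.
exact: ler_wsqrtr.
Qed.

Lemma chart_coord_chain gam a b c (i : atlas_index M) (l : 'I_m) :
  0 <= c -> smooth_chain gam a b ->
  (forall u, u \in `[a, b] -> chart_dom (atlas i) (gam u) /\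
    forall v, tangent (gam u) v -> c * `|v i| ^+ 2 <= g (gam u) v v) ->
  ((Num.sqrt c * `|atlas i (gam b) 0 l - atlas i (gam a) 0 l|)%:E <=
    arc_length g gam a b)%E.
Proof.
move=> c0; elim=> [{}a {}b arc|{}a d {}b ad IH1 db IH2] H.
  exact: chart_coord_arc.
have lad := ltW (smooth_chain_lt ad); have ldb := ltW (smooth_chain_lt db).
rewrite (arc_length_cat g ad db).
apply: le_trans (leeD (IH1 _) (IH2 _)).
- rewrite -EFinD lee_fin -mulrDr ler_wpM2l ?sqrtr_ge0 //.
  by rewrite [leRHS]addrC; exact: ler_distD.
- move=> u; rewrite in_itv /= => /andP[u1 u2]; apply: H.
  by rewrite in_itv /= u1 (le_trans u2 ldb).
move=> u; rewrite in_itv /= => /andP[u1 u2]; apply: H.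
by rewrite in_itv /= u2 (le_trans lad u1).
Qed.

Lemma chart_model_closed (i : atlas_index M) : closed (chart_model (atlas i)).
Proof.
case: (chart_modelP (atlas i)) => [->|[al [be [_ ->]]]]; first exact: closedT.
have -> : [set x : 'rV[R]_m | be <= (x *m al) ord0 ord0] =
    (fun x : 'rV[R]_m => \sum_j x 0 j * al j 0) @^-1` [set t | be <= t].
  by apply/seteqP; split => x /=; rewrite mxE.
apply: preimage_closed; last exact: closed_ge.
move=> x _; have cont : continuous (fun x : 'rV[R]_m => \sum_j x 0 j * al j 0).
  apply: continuous_big; first exact: add_continuous.
  move=> j _ {}x; have cj := @coord_continuous R _ _ 0 j x.
  exact: (cvgM cj (@cvg_cst _ (al j 0) _ (nbhs x) _)).
exact: cont.
Qed.

Lemma dist_continuous (V : normedModType R) (x : V) : continuous (fun y => `|x - y|).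
Proof.
by move=> y; apply: cvg_norm; apply: cvgB; [exact: cvg_cst|exact: cvg_id].
Qed.

Hypothesis hausM : hausdorff_space M.

(* Truncating the distance in the chart makes it a function on all of M. *)
Definition chart_radius (i : atlas_index M) p (r : R) q : R :=
  if `[< chart_dom (atlas i) q >] then Num.min `|atlas i p - atlas i q| r else r.

(** The closed chart ball [K] is the continuous image of a compact part of the model, hence closed
    as [M] is Hausdorff. Off [K] the function is constantly [r]; at points of [K] the chart is
    defined nearby. The margin [r < r'] keeps the ball where the inverse is controlled. *)
Lemma chart_radius_continuous (i : atlas_index M) p (r r' : R) :
  chart_dom (atlas i) p -> 0 < r -> r < r' ->
  (forall y, chart_model (atlas i) y -> `|atlas i p - y| < r' ->
     chart_dom (atlas i) (chart_inv (atlas i) y) /\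
     atlas i (chart_inv (atlas i) y) = y) ->
  continuous (chart_radius i p r).
Proof.
move=> ip r0 rr' inv.
pose B := [set y | chart_model (atlas i) y /\ `|atlas i p - y| <= r].
pose K := [set q | chart_dom (atlas i) q /\ `|atlas i p - atlas i q| <= r].
have KE : K = chart_inv (atlas i) @` B.
  apply/seteqP; split => q.
    move=> [iq qr]; exists (atlas i q); last exact: chart_mapK.
    by split => //; exact: chart_image_model.
  move=> [y [my yr] <-]; have [d e] := inv y my (le_lt_trans yr rr').
  by split => //; rewrite e.
have dist_cont := @dist_continuous 'rV[R]_m.
have cB : compact B.
  apply: bounded_closed_compact.
    exists (`|atlas i p| + r); split => [|t tb y /= [_ yr]]; first exact: num_real.
    apply: ltW; apply: le_lt_trans tb.
    rewrite -[y](subrK (atlas i p)) addrC; apply: le_trans (ler_normD _ _) _.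
    by rewrite lerD2l distrC.
  apply: closedI; first exact: chart_model_closed.
  exact: (@preimage_closed _ _ (fun y : 'rV[R]_m => `|atlas i p - y|) [set t | t <= r]
    (fun y _ => dist_cont (atlas i p) y) (@closed_le R r)).
have clK : closed K.
  apply: compact_closed => //; rewrite KE; apply: continuous_compact => //.
  apply: continuous_subspaceW (@chart_inv_continuous _ _ _ (atlas i)).
  move=> y [my yr]; have [d e] := inv y my (le_lt_trans yr rr').
  by exists (chart_inv (atlas i) y).
move=> q; have [[iq _]|nK] := pselect (K q).
  have nq := nbhs_chart_dom iq.
  have cv : (fun q => Num.min `|atlas i p - atlas i q| r) @ q -->
      Num.min `|atlas i p - atlas i q| r.
    apply: (@continuous_min _ _ (fun q => `|atlas i p - atlas i q|) (fun=> r));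
      last exact: cvg_cst.
    apply: (cvg_comp (atlas i) _ _ (@dist_cont _ _)).
    have := @chart_map_continuous _ _ _ (atlas i).
    rewrite continuous_open_subspace; last exact: chart_dom_open.
    by apply; rewrite inE.
  rewrite /continuous_at [X in _ --> X]/chart_radius asboolT //.
  apply: cvg_trans cv; apply: near_eq_cvg.
  by apply: filterS nq => z iz; rewrite /chart_radius asboolT.
have rad_out z : ~ K z -> chart_radius i p r z = r.
  move=> nKz; rewrite /chart_radius; case: asboolP => // iz.
  by have [zr|//] := leP `|atlas i p - atlas i z| r; case: nKz.
rewrite /continuous_at rad_out //; apply: cvg_near_cst.
have : nbhs q (~` K) by apply: open_nbhs_nbhs; split => //; exact: closed_openC.
by apply: filterS => z /rad_out.
Qed.

(** Take the least point of the compact level set; a value above [v] before it would, by the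
    intermediate value theorem, force an earlier hit. *)
Lemma first_hitting (h : R -> R) (v : R) : {within `[0, 1], continuous h} ->
  h 0 < v -> h 1 = v -> exists tau, [/\ 0 < tau, tau <= 1, h tau = v &
    forall u, 0 <= u -> u <= tau -> h u <= v].
Proof.
move=> ch h0 h1.
pose A := `[0, 1]%classic `&` h @^-1` [set v].
have cA : compact A.
  have clv : closed [set v] by exact: closed_eq.
  have /continuous_closedP /(_ _ clv) /closed_subspaceP[V clV VE] := ch.
  have -> : A = `[0, 1]%classic `&` V by rewrite /A setIC -VE setIC.
  by apply: compact_closedI => //; exact: segment_compact.
have A0 : A !=set0 by exists 1; split => //=; rewrite in_itv /= ler01 lexx.
have [tau] := compact_EVT_min A0 cA (continuous_subspaceT (fun x => @cvg_id _ (nbhs x))).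
rewrite inE => -[/= + htau] taumin; rewrite in_itv /= => /andP[t0 t1].
exists tau; split => //.
  by rewrite lt_neqAle t0 andbT; apply/eqP => t0'; move: h0; rewrite t0' htau ltxx.
move=> u u0 ut; rewrite leNgt; apply/negP => hu.
have [|||u' u'I hu'] := @IVT R h 0 u v.
- exact: u0.
- apply: continuous_subspaceW ch; apply: subset_itv; rewrite bnd_simp //.
  exact: le_trans ut t1.
- by rewrite ge_min (ltW h0) le_max (ltW hu) orbT.
move: u'I; rewrite in_itv /= => /andP[u'0 u'u].
have := taumin u' _; rewrite inE => /(_ _) tu'.
have {}tu' : tau <= u'.
  by apply: tu'; split => //=; rewrite in_itv /= u'0 (le_trans u'u) // (le_trans ut).
have eu : u = tau by apply: le_anti; rewrite ut (le_trans tu').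
by move: hu; rewrite eu htau ltxx.
Qed.

(** A path from [p] to a point at chart distance [r / 4] must cover that distance while still inside
    the chart, where the metric dominates the coordinate norm. Stopping at the first hitting time
    handles paths that leave the chart later. *)
Lemma geodesic_far_pair : (0 < m)%N -> exists p q, (0 < geodesic_dist g p q)%E.
Proof.
move=> m0; pose p : M := point; have [i ip] := atlas_cover p.
have [c [C [c0 C0 bounds]]] := gram_bounds g ip.
have [r r0 rP] := chart_inv_near ip bounds.
have r2 : 0 < r / 2 by rewrite divr_gt0.
have r4 : 0 < r / 4 by rewrite divr_gt0.
have r42 : r / 4 < r / 2 by rewrite ltr_pM2l // ltf_pV2 ?posrE // ltr_nat.
have r21 : r / 2 < r by rewrite ltr_pdivrMr // ltr_pMr // ltr1n.
have cont : continuous (chart_radius i p (r / 2)).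
  by apply: (chart_radius_continuous ip r2 r21) => y my yr; have [] := rP y my yr.
have [e e0 me] : exists2 e : 'rV[R]_m, e != 0 &
    forall t, 0 <= t -> chart_model (atlas i) (atlas i p + t *: e).
  (* A nonzero vector exists because [m > 0]; up to sign it points into the model. *)
  pose w : 'rV[R]_m := const_mx 1.
  have w0 : w != 0.
    by apply/eqP => /rowP /(_ (Ordinal m0)) /eqP; rewrite !mxE oner_eq0.
  case: (model_direction w (chart_image_model ip)) => H; first by exists w.
  by exists (- w) => //; rewrite oppr_eq0.
have ne : 0 < `|e| by rewrite normr_gt0.
pose y := atlas i p + (r / 4 / `|e|) *: e.
have my : chart_model (atlas i) y by apply: me; rewrite divr_ge0 // ltW.
have yr : `|atlas i p - y| = r / 4.
  rewrite /y opprD addNKr normrN normrZ (ger0_norm (divr_ge0 (ltW r4) (ltW ne))).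
  by rewrite divfK // gt_eqF.
have [|iq eq _] := rP y my; first by rewrite yr (lt_trans r42).
set q := chart_inv (atlas i) y in iq eq.
exists p, q.
have L0 : 0 < Num.sqrt c * (r / 4) by rewrite mulr_gt0 // sqrtr_gt0.
apply: (@lt_le_trans _ _ (Num.sqrt c * (r / 4))%:E); first by rewrite lte_fin.
rewrite leNgt; apply/negP => /geodesic_dist_lt_arc[gam [ch g0 g1 len]].
pose h u := chart_radius i p (r / 2) (gam u).
have ch_cont : {within `[0, 1], continuous h}.
  apply/subspace_continuousP => u uI.
  have /subspace_continuousP /(_ u uI) cg := smooth_chain_continuous ch.
  exact: (cvg_comp gam (chart_radius i p (r / 2)) cg (cont _)).
have h0 : h 0 < r / 4.
  by rewrite /h g0 /chart_radius asboolT // subrr normr0 min_l // ltW.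
have h1 : h 1 = r / 4.
  by rewrite /h g1 /chart_radius asboolT // eq yr min_l // ltW.
have [tau [tau0 tau1 htau hle]] := first_hitting ch_cont h0 h1.
(* The truncation level [r / 2] exceeds [r / 4], so a value of at most [r / 4] is a genuine distance
   measured in the chart. *)
have inside u : 0 <= u -> u <= tau -> chart_dom (atlas i) (gam u) /\
    `|atlas i p - atlas i (gam u)| = h u.
  move=> u0 ut; have := hle u u0 ut; rewrite /h /chart_radius.
  case: asboolP => [iu|_ h2]; last by move: (lt_le_trans r42 h2); rewrite ltxx.
  rewrite ge_min => /orP[h2|h2]; last by move: (lt_le_trans r42 h2); rewrite ltxx.
  by rewrite min_l // (le_trans h2) // ltW.
have [_ dtau] := inside tau (ltW tau0) (lexx _).
rewrite htau in dtau.
(* The norm of a row is the largest absolute value of its entries, so one coordinate carries the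
   full displacement. *)
have [l dl] : exists l, `|(atlas i (gam tau) - atlas i p) 0 l| = r / 4.
  have nz : mx_norm (atlas i (gam tau) - atlas i p) != 0.
    rewrite [X in X != 0](_ : _ = `|atlas i (gam tau) - atlas i p|) //.
    by rewrite distrC dtau gt_eqF.
  have [[k l] /= kl] := mx_norm_neq0 nz; exists l.
  rewrite -dtau distrC [RHS](_ : _ = mx_norm (atlas i (gam tau) - atlas i p)) // kl.
  by rewrite (ord1 k).
have ctau := smooth_chain_restrict ch tau0 tau1.
have low : ((Num.sqrt c * (r / 4))%:E <= arc_length g gam 0 tau)%E.
  have := @chart_coord_chain gam 0 tau c i l (ltW c0) ctau.
  rewrite g0 -dl !mxE; apply=> u; rewrite in_itv /= => /andP[u0 ut].
  have [iu du] := inside u u0 ut; split => //.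
  have [||_ _] := rP (atlas i (gam u)); first exact: chart_image_model.
    by rewrite du; apply: le_lt_trans (hle u u0 ut) (lt_trans r42 r21).
  by rewrite chart_mapK // => -[_ b] v tv; have /andP[] := b v tv.
have := le_lt_trans (le_trans low (arc_length_restrict g ch tau0 tau1)) len.
by rewrite ltxx.
Qed.

End far_points.

Theorem theorem1p3 (R : realType) (m : nat) (hm : (0 < m)%N)
    (M : C1_manifold R m)
    (hcompact : compact [set: M]) (hconnected : connected [set: M])
    (g : riemannian_metric M)
    (mu : {measure set (borel M) -> \bar R})
    (hmu : ahlfors_david_regular (geodesic_dist g) mu) :
  exists d C : R, 0 < d /\ 0 < C /\
    forall (n : nat) (lam : 'I_n -> R),
      (forall j, 0 < lam j) ->
      (\sum_(j < n) lam j)%:E = mu [set: M] ->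
      exists X : 'I_n -> set (borel M),
        [/\ forall j, measurable (X j),
            \bigcup_(j in [set: 'I_n]) X j = [set: M],
            trivIset [set: 'I_n] X,
            forall j, mu (X j) = (lam j)%:E &
            forall j, exists x : M,
              X j `<=` dball (geodesic_dist g) x (C * (lam j `^ d^-1))].
Proof.
apply: (regular_measure_decomposition (geodesic_ball_system g) hconnected _ hmu).
exact: geodesic_far_pair (@manifold_hausdorff R m M) hm.
Qed.
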